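(* Let $\{M(t)\}_{t\ge0}$ be the generalized counting process with rates $\lambda_1,\dots,\lambda_k>0$, $\Lambda=\lambda_1+\cdots+\lambda_k$, $\{D_f(t)\}_{t\ge0}$ a Lévy subordinator with Bernstein function $f$, and $\{Y_\alpha(t)\}_{t\ge0}$, $0<\alpha<1$, an inverse stable subordinator, all independent of each other. The state probabilities $p_f^\alpha(n,t)=\Pr\{\mathscr{M}_f^\alpha(t)=n\}$, $n\ge0$, of the process $\mathscr{M}_f^\alpha(t)=M(D_f(Y_\alpha(t)))$ solve the system of fractional differential equations $$\frac{\mathrm{d}^{\alpha}}{\mathrm{d}t^{\alpha}}p_{f}^{\alpha}(n,t)=-f(\Lambda)p_{f}^{\alpha}(n,t)-\sum_{m=1}^{n}\sum_{ \Omega(k,m)}f^{(z_{k})}(\Lambda)\left(\prod_{j=1}^{k}\frac{(-\lambda_{j})^{x_{j}}}{x_{j}!}\right)p_{f}^{\alpha}(n-m,t),$$ with initial conditions $p_f^\alpha(0,0)=1$ and $p_f^\alpha(n,0)=0$ for $n\ge1$, where $z_k=x_1+\cdots+x_k$.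
   Context: Generalized counting process (GCP): the Lévy process $\{M(t)\}_{t\ge0}$ with values in the non-negative integers, $M(0)=0$, and $\Pr\{M(t)=n\}=\sum_{\Omega(k,n)}\prod_{j=1}^{k}\frac{(\lambda_{j}t)^{x_{j}}}{x_{j}!}e^{-\Lambda t}$, where $\Omega(k,n)=\{(x_1,\dots,x_k): x_j\in\{0,1,2,\dots\},\ \sum_{j=1}^k jx_j=n\}$. Lévy subordinator: a (finite-valued) non-decreasing Lévy process with $\mathbb{E}(e^{-sD_f(t)})=e^{-tf(s)}$, where $f(s)=c_2s+\int_0^\infty(1-e^{-sx})\,\overline\nu(\mathrm{d}x)$, $c_2\ge0$, $\int_0^\infty(x\wedge1)\,\overline\nu(\mathrm{d}x)<\infty$, so $f(0)=0$; $f^{(r)}$ is the $r$-th derivative. Inverse stable subordinator: $Y_\alpha(t)=\inf\{x\ge0:D_\alpha(x)>t\}$ with $\mathbb{E}(e^{-sD_\alpha(t)})=e^{-ts^\alpha}$. $\frac{\mathrm{d}^\alpha}{\mathrm{d}t^\alpha}u(t)=\frac{1}{\Gamma(1-\alpha)}\int_0^t(t-s)^{-\alpha}u'(s)\,\mathrm{d}s$ is the Caputo fractional derivative. *)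

(* Defs.v *)
From mathcomp Require Import all_boot all_order all_algebra.
From mathcomp Require Import all_classical all_reals all_analysis.

Set Implicit Arguments.
Unset Strict Implicit.
Unset Printing Implicit Defensive.

Import Order.TTheory GRing.Theory Num.Theory.
Import numFieldNormedType.Exports.

Local Open Scope classical_set_scope.
Local Open Scope ring_scope.

Definition mutually_independent {d : measure_display} {T : measurableType d}
    {R : realType} (P : probability T R) (I : finType)
    (F : I -> set (set T)) : Prop :=
  forall (J : {set I}) (A : I -> set T),
    (forall i, i \in J -> F i (A i)) ->
    fine (P (\bigcap_(i in [set` J]) A i)) = \prod_(i in J) fine (P (A i)).

Definition rv_events {d : measure_display} {T : measurableType d}
    {R : realType} (X : T -> R) : set (set T) :=
  preimage_set_system setT X measurable.

(* Processes are families X : R -> T -> R; only the times t >= 0 matter. *)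
Definition process_sigma {d : measure_display} {T : measurableType d}
    {R : realType} (X : R -> T -> R) : set (set T) :=
  <<s \bigcup_(t in [set t : R | 0 <= t]) rv_events (X t) >>.

Definition independent3 {d : measure_display} {T : measurableType d}
    {R : realType} (P : probability T R) (X Y Z : R -> T -> R) : Prop :=
  mutually_independent P (fun i : 'I_3 =>
    nth set0 [:: process_sigma X; process_sigma Y; process_sigma Z] i).

Definition cadlag {R : realType} (x : R -> R) : Prop :=
  (forall t, 0 <= t -> x s @[s --> t^'+] --> x t) /\
  (forall t, 0 < t -> cvg (x s @[s --> t^'-])).

(* The path properties (start at 0, cadlag) are required of every path, not
   just almost every one, so that X composed with a random time is again a
   random variable without completing the probability space. *)
Definition levy_process {d : measure_display} {T : measurableType d}
    {R : realType} (P : probability T R) (X : R -> T -> R) : Prop :=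
  [/\ forall t, 0 <= t -> measurable_fun setT (X t),
      forall w, X 0 w = 0,
      forall w, cadlag (X ^~ w)
    & [/\ (forall (n : nat) (t : nat -> R), 0 <= t 0%N ->
             (forall i, t i <= t i.+1) ->
             mutually_independent P
               (fun i : 'I_n => rv_events (fun w => X (t i.+1) w - X (t i) w))),
          (forall (s h : R) (B : set R), 0 <= s -> 0 <= h -> measurable B ->
             P [set w | B (X (s + h) w - X s w)] = P [set w | B (X h w)])
        & (forall t eps : R, 0 <= t -> 0 < eps ->
             P [set w | eps < `|X s w - X t w|]
               @[s --> within `[0, +oo[ (nbhs t)] --> 0%E)]].

(* Levy subordinator with Laplace exponent phi. *)
Definition subordinator {d : measure_display} {T : measurableType d}
    {R : realType} (P : probability T R) (phi : R -> R) (D : R -> T -> R)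
    : Prop :=
  [/\ levy_process P D,
      forall w s t, 0 <= s -> s <= t -> D s w <= D t w
    & forall s t, 0 <= s -> 0 <= t ->
        ('E_P[fun w => expR (- (s * D t w))] = (expR (- (t * phi s)))%:E)%E].

(* Only the values of f on [0, +oo[ are prescribed. *)
Definition bernstein {R : realType} (f : R -> R) : Prop :=
  exists (c : R) (nu : {measure set (measurableTypeR R) -> \bar R}),
    [/\ 0 <= c,
        (\int[nu]_(x in `]0%R, +oo[) (Num.min x 1)%:E < +oo)%E
      & forall s, 0 <= s ->
          f s = c * s + \int[nu]_(x in `]0, +oo[) (1 - expR (- (s * x)))].

Definition inverse_process {T : Type} {R : realType} (D : R -> T -> R)
    : R -> T -> R :=
  fun t w => inf [set x | 0 <= x /\ t < D x w].

(* The tuples (x_1, ..., x_k) of naturals with sum_j j x_j = n. The coordinate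
   x_j is indexed by j - 1 : 'I_k, and the constraint forces x_j <= n. *)
Definition Omega (k n : nat) : {set {ffun 'I_k -> 'I_n.+1}} :=
  [set x : {ffun 'I_k -> 'I_n.+1} | \sum_(j < k) j.+1 * x j == n]%N%SET.

Definition total_rate {R : realType} (k : nat) (lambda : 'I_k -> R) : R :=
  \sum_(j < k) lambda j.

Definition counting_process {d : measure_display} {T : measurableType d}
    {R : realType} (P : probability T R) (k : nat) (lambda : 'I_k -> R)
    (M : R -> T -> nat) : Prop :=
  levy_process P (fun t w => (M t w)%:R) /\
  forall (t : R) (n : nat), 0 <= t ->
    P [set w | M t w = n] =
    (\sum_(x in Omega k n)
       (\prod_(j < k) ((lambda j * t) ^+ x j / (x j)`!%:R))
       * expR (- (total_rate lambda * t)))%:E.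

Definition Gamma {R : realType} (z : R) : R :=
  \int[lebesgue_measure]_(x in `]0, +oo[) (x `^ (z - 1) * expR (- x)).

Definition caputo_integrand {R : realType} (alpha : R) (u : R -> R) (t : R)
    : R -> R :=
  fun s => (t - s) `^ (- alpha) * derive1 u s.

Definition caputo {R : realType} (alpha : R) (u : R -> R) (t : R) : R :=
  (Gamma (1 - alpha))^-1 *
  \int[lebesgue_measure]_(s in `]0, t[) caputo_integrand alpha u t s.

(* [caputo] is total; this says that its value at t is genuine. The conditions
   make u absolutely continuous on [0, t], since (t - s)^(- alpha) is bounded
   below by t^(- alpha) on ]0, t[. *)
Definition caputo_defined {R : realType} (alpha : R) (u : R -> R) (t : R)
    : Prop :=
  [/\ {within `[0, t], continuous u},
      forall s, 0 < s -> s < t -> derivable u s 1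
    & lebesgue_measure.-integrable `]0, t[
        (EFin \o caputo_integrand alpha u t)].

Definition state_probability {d : measure_display} {T : measurableType d}
    {R : realType} (P : probability T R) (X : R -> T -> nat) (n : nat) (t : R)
    : R :=
  fine (P [set w | X t w = n]).

(* Main.v *)
Require Import Defs.
From mathcomp Require Import all_boot all_order all_algebra.
From mathcomp Require Import all_classical all_reals all_analysis measurable_realfun.
From mathcomp Require Import ring lra.
Import Order.TTheory GRing.Theory Num.Theory.
Import numFieldNormedType.Exports.
Set Implicit Arguments.
Unset Strict Implicit.
Unset Printing Implicit Defensive.
Local Open Scope classical_set_scope.
Local Open Scope ring_scope.

(** The proof computes the state probabilities in closed form and then
differentiates the formula term by term.

Let [C] be the polynomial with coefficients
  [c_m = sum over Omega k m of f^(z)(Lambda) prod_j (-lambda_j)^(x_j) / x_j!],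
so that [c_0 = f Lambda] and the equation to prove reads
  [d^alpha/dt^alpha p_n = - sum_(m <= n) c_m p_(n-m)].
Put [b_(n,j) = (-1)^j [X^n] C^j] ([state_coef]).  Then [b_(n,0)] is [1] if
[n = 0] and [0] otherwise, and [C^(j+1) = C C^j] gives
[b_(n,j+1) = - sum_(m <= n) c_m b_(n-m,j)].  The formula is
  [p_n(t) = sum_j b_(n,j) t^(alpha j) / Gamma(alpha j + 1)],
a Mittag-Leffler type series ([mittag_leffler]).  The Caputo derivative shifts
the coefficients of such a series by one ([caputo_mittag_leffler]), so the
recursion for [b] is the equation, and the value at [t = 0] is [b_(n,0)].

Four facts give the formula.

- Conditioning.  By independence
  [p_n(t) = E (q_n (Y t))] with [q_n(y) = E (P (M x = n) at x = Df y)]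
  ([random_time_law]).  Replacing the random times by grid points slightly to
  their right makes this an identity between countable sums; right-continuity
  of the paths and dominated convergence remove the grid.

- The series [q_n(y) = sum_j b_(n,j) y^j / j!] ([state_series]).  The law of [M]
  writes [q_n(y)] with the moments [E ((- Df y)^r exp(- Lambda Df y))], which
  are the derivatives at [Lambda] of [exp (- y f)].  The derivatives of
  [exp (- y f)] at [Lambda] are determined by those of [f] through
  [(exp (- y f))' = - y f' exp (- y f)], and the solution is
  [exp (- y A) = sum_j (- y)^j A^j / j!], with [A] the Taylor polynomial of [f]
  at [Lambda].  The sum over [Omega k n] is the coefficient of [X^n] after the
  substitution of [sum_j - lambda_j X^j] in [A], and that substitution turns
  [A] into [C].  The smoothness of [f] comes from that of its Laplace
  transform: [exp (- f s) = E (exp (- s Df 1))].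

- The moments [E ((Y t)^j) = j! t^(alpha j) / Gamma(alpha j + 1)]
  ([inverse_process_moment]).  The layer-cake formula expresses them by
  [P (D x <= t)], whose Laplace transform in [t] is [exp (- x s^alpha) / s]; the
  moment, as a function of [t], is nondecreasing and has the Laplace transform
  of a power of [t], and a Laplace transform determines a monotone function at
  the points of continuity ([laplace_inj]).

- Gamma and Beta integrals ([convol_powkerE]), from the Laplace transform of the
  powers of [x] on the half-line and the homogeneity of their convolutions.
  They give the functional equation of Gamma and the Caputo derivative of a
  power of [t]. *)

(** * Change of variable and Tonelli's theorem on the line *)
Section affine_change.
Context {R : realType}.
Local Notation mu := (@lebesgue_measure R).
Local Open Scope ereal_scope.

Let affine (c b : R) : measurableTypeR R -> measurableTypeR R :=
  fun x => (c * x + b)%R.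

Let measurable_affine c b : measurable_fun setT (affine c b).
Proof. by apply: measurable_funD => //; exact: measurable_funM. Qed.

Let affine_measure (c : {nonneg R}) (b : R) :
  {measure set (measurableTypeR R) -> \bar R}.
Proof.
unshelve refine (mscale c (pushforward mu (affine c%:num b))).
exact: measurable_affine.
Defined.

Lemma lebesgue_measure_affine (c : {nonneg R}) (b : R) (A : set R) :
  (0 < c%:num)%R -> measurable A -> mu A = affine_measure c b A.
Proof.
move=> c0 mA.
apply: lebesgue_measure_unique => //= _ [[x y]] _ <-.
rewrite /mscale/= /pushforward.
have -> : affine c%:num b @^-1` `]x, y] =
    `]((x - b) / c%:num)%R, ((y - b) / c%:num)%R]%classic.
  by apply/seteqP; split=> t /=;
    rewrite !in_itv/= /affine ltr_pdivrMr// ler_pdivlMr// ltrBlDr lerBrDr mulrC.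
rewrite !lebesgue_measure_itv/= !lte_fin.
rewrite ltr_pM2r ?invr_gt0// ltrD2r; case: ifPn => _; last by rewrite mule0.
by rewrite -!EFinB -EFinM -mulrBl mulrCA divff ?gt_eqF// mulr1; congr EFin; ring.
Qed.

Lemma ge0_integral_affine (c b : R) (g : R -> \bar R) : (0 < c)%R ->
  measurable_fun setT g -> (forall x, 0 <= g x) ->
  \int[mu]_x g x = c%:E * \int[mu]_x g (c * x + b)%R.
Proof.
move=> c0 mg g0.
pose c' := NngNum (ltW c0).
transitivity (\int[affine_measure c' b]_x g x).
  by apply: eq_measure_integral => A mA _; exact: lebesgue_measure_affine.
rewrite ge0_integral_mscale//=; congr (_ * _).
rewrite ge0_integral_pushforward//=.
Qed.

End affine_change.

Lemma tonelli_swap d1 d2 (T1 : measurableType d1) (T2 : measurableType d2)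
    (R : realType) (m1 : {sigma_finite_measure set T1 -> \bar R})
    (m2 : {sigma_finite_measure set T2 -> \bar R}) (f : T1 -> T2 -> \bar R) :
  measurable_fun setT (fun z => f z.1 z.2) -> (forall x y, 0 <= f x y)%E ->
  (\int[m1]_x \int[m2]_y f x y = \int[m2]_y \int[m1]_x f x y)%E.
Proof. by move=> mf f0; exact: (fubini_tonelli (fun z => f z.1 z.2)). Qed.

Lemma measurable_tonelli d1 d2 (T1 : measurableType d1) (T2 : measurableType d2)
    (R : realType) (m2 : {sigma_finite_measure set T2 -> \bar R})
    (f : T1 -> T2 -> \bar R) :
  measurable_fun setT (fun z => f z.1 z.2) -> (forall x y, 0 <= f x y)%E ->
  measurable_fun setT (fun x => \int[m2]_y f x y)%E.
Proof.
move=> mf f0.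
exact: (@measurable_fun_fubini_tonelli_F _ _ _ _ _ m2 (fun z => f z.1 z.2)).
Qed.

(** * Laplace transforms and convolutions of powers *)
Section power_kernel.
Context {R : realType}.
Local Notation mu := (@lebesgue_measure R).
Implicit Types (a b s t x y : R) (g h : R -> R).

Lemma powRDp x a b : 0 < x -> x `^ (a + b) = x `^ a * x `^ b.
Proof. by move=> x0; rewrite powRD//; apply/implyP => _; rewrite gt_eqF. Qed.

(** The power [x^(a-1)] on the half-line, extended by [0], so that Laplace
transforms and convolutions are integrals over all of [R]. *)
Definition powker a x : R := if 0 < x then x `^ (a - 1) else 0.

Lemma powker_ge0 a x : 0 <= powker a x.
Proof. by rewrite /powker; case: ifP => // _; exact: powR_ge0. Qed.

Lemma powkerE a x : 0 < x -> powker a x = x `^ (a - 1).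
Proof. by rewrite /powker => ->. Qed.

Lemma powker_le0 a x : x <= 0 -> powker a x = 0.
Proof. by rewrite /powker ltNge => ->. Qed.

Lemma measurable_powker a : measurable_fun setT (powker a).
Proof.
apply: measurable_fun_ifT => //; exact: measurable_fun_ltr.
Qed.

Lemma powker_scale a c x : 0 < c -> powker a (c * x) = c `^ (a - 1) * powker a x.
Proof.
move=> c0; rewrite /powker pmulr_rgt0//; case: ifPn => x0; last by rewrite mulr0.
by rewrite powRM// ltW.
Qed.

Lemma measurable_expRN c : measurable_fun setT (fun x : R => expR (- (c * x))).
Proof.
by apply: measurableT_comp => //; apply: measurable_funN; exact: measurable_funM.
Qed.

Definition laplace g s : \bar R := (\int[mu]_x (expR (- (s * x)) * g x)%:E)%E.

Definition convol g h t : \bar R := (\int[mu]_y (g (t - y) * h y)%:E)%E.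

(** Tonelli, and the translation [t = x + y] in the inner integral. *)
Lemma laplace_convol g h s : measurable_fun setT g -> measurable_fun setT h ->
  (forall x, 0 <= g x) -> (forall x, 0 <= h x) ->
  (\int[mu]_t ((expR (- (s * t)))%:E * convol g h t) = laplace g s * laplace h s)%E.
Proof.
move=> mg mh g0 h0.
have mf : measurable_fun [set: R * R]
    (fun z => (expR (- (s * z.1)) * (g (z.1 - z.2) * h z.2))%:E).
  apply/measurable_EFinP; apply: measurable_funM.
    by apply: (measurableT_comp (measurable_expRN s)).
  apply: measurable_funM; last exact: (measurableT_comp mh).
  by apply: (measurableT_comp mg); exact: measurable_funB.
transitivity (\int[mu]_t \int[mu]_y (expR (- (s * t)) * (g (t - y) * h y))%:E)%E.
  apply: eq_integral => t _; rewrite /convol -ge0_integralZl//.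
  - apply/measurable_EFinP/measurable_funM => //.
    by apply: (measurableT_comp mg); exact: measurable_funB.
  - by move=> y _; rewrite lee_fin mulr_ge0.
rewrite (@tonelli_swap _ _ _ _ _ mu mu (fun t y => (expR (- (s * t)) * (g (t - y) * h y))%:E) mf); last by move=> x y; rewrite lee_fin !mulr_ge0 ?expR_ge0.
have inner y : (\int[mu]_x (expR (- (s * x)) * (g (x - y) * h y))%:E =
    laplace g s * (expR (- (s * y)) * h y)%:E)%E.
  have mk : measurable_fun setT (fun x => (expR (- (s * x)) * (g (x - y) * h y))%:E).
    apply/measurable_EFinP; apply: measurable_funM; first exact: measurable_expRN.
    apply: measurable_funM => //.
    by apply: (measurableT_comp mg); exact: measurable_funB.
  rewrite (@ge0_integral_affine _ 1 y)//; last first.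
    by move=> x; rewrite lee_fin !mulr_ge0 ?expR_ge0.
  rewrite mul1e muleC /laplace -ge0_integralZl//.
  - apply: eq_integral => x _; rewrite -EFinM mul1r addrK mulrDr opprD expRD.
    by congr EFin; ring.
  - apply/measurable_EFinP; apply: measurable_funM mg.
    exact: measurable_expRN.
  - by move=> x _; rewrite lee_fin mulr_ge0 ?expR_ge0.
  - by rewrite lee_fin mulr_ge0 ?expR_ge0.
under eq_integral do rewrite inner.
rewrite ge0_integralZl//.
- apply/measurable_EFinP; apply: measurable_funM mh.
  exact: measurable_expRN.
- by move=> x _; rewrite lee_fin mulr_ge0 ?expR_ge0.
- by apply: integral_ge0 => x _; rewrite lee_fin mulr_ge0 ?expR_ge0.
Qed.

Lemma laplace_powker a s : 0 < s ->
  laplace (powker a) s = ((s `^ (- a))%:E * laplace (powker a) 1)%E.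
Proof.
move=> s0; have mp := measurable_powker a.
rewrite [in RHS]/laplace (@ge0_integral_affine _ s 0)//; last 2 first.
- apply/measurable_EFinP/measurable_funM => //.
  exact: measurable_expRN.
- by move=> x; rewrite lee_fin mulr_ge0 ?expR_ge0// powker_ge0.
rewrite muleA -EFinM.
transitivity ((s `^ (- a) * s)%:E * ((s `^ (a - 1))%:E * laplace (powker a) s))%E.
  have -> : s `^ (- a) * s = s `^ (- a + 1) by rewrite powRDp// powRr1// ltW.
  rewrite muleA -EFinM -powRDp// (_ : - a + 1 + (a - 1) = 0) ?powRr0 ?mul1e//.
  ring.
congr (_ * _)%E.
rewrite /laplace -ge0_integralZl//.
- by apply: eq_integral => x _; rewrite addr0 mul1r powker_scale// -EFinM; congr EFin; ring.
- apply/measurable_EFinP/measurable_funM => //.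
  exact: measurable_expRN.
- by move=> x _; rewrite lee_fin mulr_ge0 ?expR_ge0// powker_ge0.
- by rewrite lee_fin powR_ge0.
Qed.

(** Homogeneity, by the substitution [y = t y']: the Beta integral on [[0, t]] is
the one on [[0, 1]] times a power of [t]. *)
Lemma convol_powker a b t :
  convol (powker a) (powker b) t =
  ((powker (a + b) t)%:E * convol (powker a) (powker b) 1)%E.
Proof.
have mp c := measurable_powker c.
have mf : measurable_fun setT (fun y => (powker a (t - y) * powker b y)%:E).
  apply/measurable_EFinP/measurable_funM => //.
  by apply: (measurableT_comp (mp a)); exact: measurable_funB.
have [t0|t0] := ltP 0 t; last first.
  rewrite [powker (_ + _) t]powker_le0// mul0e /convol integral0_eq// => y _.
  have [y0|y0] := ltP 0 y; last by rewrite (powker_le0 _ y0) mulr0.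
  by rewrite powker_le0 ?mul0r// subr_le0 (le_trans t0)// ltW.
have f0 y : (0 <= (powker a (t - y) * powker b y)%:E)%E.
  by rewrite lee_fin mulr_ge0// powker_ge0.
rewrite /convol (ge0_integral_affine 0 t0 mf f0) (powkerE (a + b) t0).
have -> : t `^ (a + b - 1) = t * (t `^ (a - 1) * t `^ (b - 1)).
  by rewrite -{2}(powRr1 (ltW t0)) -!powRDp//; congr powR; ring.
rewrite EFinM -muleA; congr (_ * _)%E.
rewrite -ge0_integralZl//.
- apply: eq_integral => y _; rewrite addr0 -EFinM.
  have -> : t - t * y = t * (1 - y) by ring.
  by rewrite !powker_scale//; congr EFin; ring.
- apply/measurable_EFinP/measurable_funM => //.
  by apply: (measurableT_comp (mp a)); exact: measurable_funB.
  exact: mp.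
- by move=> y _; rewrite lee_fin mulr_ge0// powker_ge0.
- by rewrite lee_fin mulr_ge0// powR_ge0.
Qed.

(** The only Beta integral computed by hand; all others follow from it through
[Gammae_mul] and the functional equation of Gamma. *)
Lemma convol_powker1 b : 0 < b -> convol (powker 1) (powker b) 1 = (b^-1)%:E.
Proof.
move=> b0.
transitivity (\int[mu]_(y in `]0%R, 1%R]) (y `^ (b - 1))%:E)%E.
  rewrite -integral_itv_bndo_bndc; last first.
    apply/measurable_EFinP; exact: (@measurable_funS _ _ _ _ setT).
  rewrite integral_mkcond; apply: eq_integral => y _.
  rewrite patchE mem_setE/= in_itv/= /powker subr_gt0 subrr powRr0.
  by case: ifPn => [y1|]; case: ifPn => y0; rewrite ?mul1r ?mulr0 ?mul0r.
pose F (n : nat) : set R := `[(n.+2%:R)^-1, 1]%classic.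
have -> : `]0%R, 1%R]%classic = \bigcup_n F n.
  apply/seteqP; split=> y /=; rewrite in_itv/=.
  - move=> /andP[y0 y1]; have [n _ ny] := near_infty_natSinv_lt (PosNum y0).
    exists n => //; rewrite /F/= in_itv/= y1 andbT.
    have /ltW := ny n.+1 (leqnSn n); exact.
  - move=> [n _]; rewrite /F/= in_itv/= => /andP[ny ->]; rewrite andbT.
    by apply: lt_le_trans ny; rewrite invr_gt0.
have mp : measurable_fun setT (fun y : R => (y `^ (b - 1))%:E).
  by apply/measurable_EFinP; exact: measurable_powR.
have nF : nondecreasing_seq F.
  apply/nondecreasing_seqP => n; rewrite subsetEset => y /=.
  rewrite /F/= !in_itv/= => /andP[ny ->]; rewrite andbT (le_trans _ ny)//.
  by rewrite lef_pV2 ?posrE// ler_nat.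
have cF : ((\int[mu]_(y in F i) (y `^ (b - 1))%:E) @[i --> \oo] -->
    \int[mu]_(y in \bigcup_i F i) (y `^ (b - 1))%:E)%E.
  apply: ge0_nondecreasing_set_cvg_integral => //.
  - by move=> i; exact: measurable_itv.
  - by move=> i; exact: (@measurable_funS _ _ _ _ setT).
  - by move=> i x _; rewrite lee_fin powR_ge0.
have Fcont x : 0 < x -> {for x, continuous (fun y => b^-1 * y `^ b)}.
  move=> x0; apply: differentiable_continuous; apply/derivable1_diffP.
  apply: derivableM => //; apply: derivable_powR; rewrite in_itv/= x0//.
have FE n : (\int[mu]_(y in F n) (y `^ (b - 1))%:E = (b^-1 - b^-1 * (n.+2%:R)^-1 `^ b)%:E)%E.
  have n0 : 0 < n.+2%:R^-1 :> R by rewrite invr_gt0.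
  rewrite /F (@continuous_FTC2 _ _ (fun y => b^-1 * y `^ b)).
  - by rewrite powR1 mulr1.
  - by rewrite invf_lt1// ltr1n.
  - apply: derivable_within_continuous => x; rewrite in_itv/= => /andP[nx _].
    by apply: derivable_powR; rewrite in_itv/= (lt_le_trans n0).
  - split.
    + move=> x; rewrite in_itv/= => /andP[nx _].
      by apply: derivableM => //; apply: derivable_powR; rewrite in_itv/= (lt_trans n0).
    + by apply: cvg_at_right_filter; exact: Fcont.
    + by apply: cvg_at_left_filter; exact: Fcont.
  - move=> x; rewrite in_itv/= => /andP[/(lt_trans n0) x0 _].
    have dF := is_derive1_powR b x0.
    rewrite derive1E derive_val.
    by rewrite /GRing.scale/= mulrA mulVf ?mul1r ?gt_eqF.
rewrite -(cvg_lim _ cF)//; apply/cvg_lim => //.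
under eq_fun do rewrite FE.
apply: cvg_EFin; first exact: nearW.
rewrite [X in _ --> X](_ : _ = b^-1 - b^-1 * 0); last by rewrite mulr0 subr0.
apply: cvgB; first exact: cvg_cst.
apply: cvgMr.
have /cvg_at_rightP := powR_cvg0 b0; apply; split; first by move=> n; rewrite invr_gt0.
rewrite (_ : (fun n => _) = (fun n => (n + 1).+1%:R^-1)); last by apply/funext => n; rewrite addn1.
by rewrite (@cvg_shiftn 1 R (fun n => n.+1%:R^-1)); exact: cvg_harmonic.
Qed.

End power_kernel.

(** * The Gamma function *)
Section gamma.
Context {R : realType}.
Local Notation mu := (@lebesgue_measure R).
Implicit Types (a b s t x y : R) (g h : R -> R).

Local Notation Gammae a := (laplace (powker a) 1).

Lemma laplace_ge0 g s : (forall x, 0 <= g x) -> (0 <= laplace g s)%E.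
Proof.
by move=> g0; apply: integral_ge0 => x _; rewrite lee_fin mulr_ge0// expR_ge0.
Qed.

Lemma measurable_laplace_integrand g s : measurable_fun setT g ->
  measurable_fun setT (fun x => (expR (- (s * x)) * g x)%:E).
Proof.
move=> mg; apply/measurable_EFinP; apply: measurable_funM mg.
exact: measurable_expRN.
Qed.

Lemma laplace_mono g h s : measurable_fun setT g -> measurable_fun setT h ->
  (forall x, 0 <= g x <= h x) -> (laplace g s <= laplace h s)%E.
Proof.
move=> mg mh gh; apply: ge0_le_integral => //.
- by move=> x _; rewrite lee_fin mulr_ge0 ?expR_ge0//; case/andP: (gh x).
- exact: measurable_laplace_integrand.
- exact: measurable_laplace_integrand.
- by move=> x _; rewrite lee_fin ler_wpM2l ?expR_ge0//; case/andP: (gh x).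
Qed.

Lemma Gammae1 : Gammae (1 : R) = 1%E.
Proof.
transitivity (\int[mu]_(x in `[0%R, +oo[) (expR (- x))%:E)%E.
  rewrite -integral_itv_obnd_cbnd; last first.
    apply/measurable_EFinP; apply: (@measurable_funS _ _ _ _ setT) => //.
    by apply: measurableT_comp => //; exact: measurable_funN.
  rewrite [RHS]integral_mkcond; apply: eq_integral => x _.
  rewrite patchE mem_setE/= in_itv/= andbT /powker subrr powRr0 mul1r.
  by case: ifPn => _; rewrite ?mulr1 ?mulr0.
have cN x : {for x, continuous (fun x => - expR (- x) : R)}.
  apply: differentiable_continuous; exact/derivable1_diffP.
rewrite (@ge0_continuous_FTC2y _ _ (fun x => - expR (- x)) _ 0).
- by rewrite oppr0 expR0 EFinN oppeK add0e.
- by move=> x _; rewrite expR_ge0.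
- apply: continuous_subspaceT => x; apply: differentiable_continuous.
  exact/derivable1_diffP.
- by rewrite -oppr0; apply: cvgN; exact: cvgr_expR.
- by move=> x _.
- by apply: cvg_at_right_filter; exact: cN.
- by move=> x _; rewrite derive1E derive_val /GRing.scale/= mulrN1 opprK.
Qed.

(** The product of two Laplace transforms is the transform of the convolution,
which is a multiple of a power kernel by homogeneity. *)
Lemma Gammae_mul a b :
  (Gammae a * Gammae b = convol (powker a) (powker b) 1 * Gammae (a + b))%E.
Proof.
rewrite -laplace_convol; try exact: measurable_powker; try exact: powker_ge0.
have c0 : (0 <= convol (powker a) (powker b) 1)%E.
  by apply: integral_ge0 => y _; rewrite lee_fin mulr_ge0// powker_ge0.
rewrite /laplace -ge0_integralZl//.
- apply: eq_integral => t _.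
  by rewrite convol_powker muleA -EFinM muleC.
- apply: measurable_laplace_integrand; exact: measurable_powker.
- by move=> x _; rewrite lee_fin mulr_ge0 ?expR_ge0// powker_ge0.
Qed.

Lemma GammaeS b : 0 < b -> Gammae (b + 1) = (b%:E * Gammae b)%E.
Proof.
move=> b0; have := Gammae_mul 1 b; rewrite Gammae1 convol_powker1// mul1e => ->.
by rewrite muleA -EFinM divff ?gt_eqF// mul1e addrC.
Qed.

Lemma Gammae_nat n : Gammae (n.+1%:R : R) = (n`!%:R)%:E.
Proof.
elim: n => [|n IH]; first by rewrite Gammae1.
by rewrite -natr1 GammaeS// IH -EFinM factS natrM.
Qed.

(** Finiteness at the integers bounds the values in between, and the functional
equation then covers the exponents below [1]. *)
Lemma Gammae_lty a : 0 < a -> (Gammae a < +oo)%E.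
Proof.
suff H b : 1 <= b -> (Gammae b < +oo)%E.
  move=> a0; have := H (a + 1); rewrite lerDr => /(_ (ltW a0)).
  rewrite GammaeS//; have := laplace_ge0 1 (powker_ge0 a).
  by case: (Gammae a) => [r|_|]//=; rewrite ?ltry// gt0_muley// lte_fin.
move=> b1.
have [n bn] : exists n, b <= n.+1%:R.
  exists (Num.truncn b); exact/ltW/truncnS_gt.
apply: (@le_lt_trans _ _ (laplace (fun x => powker 1 x + powker n.+1%:R x) 1)).
  apply: laplace_mono; first exact: measurable_powker.
    by apply: measurable_funD; exact: measurable_powker.
  move=> x; rewrite powker_ge0/=; have [x0|x0] := ltP 0 x; last first.
    by rewrite !powker_le0// addr0.
  rewrite !powkerE// subrr powRr0.
  have [x1|x1] := leP x 1.
    apply: (@le_trans _ _ 1); last by rewrite lerDl powR_ge0.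
    rewrite -{2}(powRr0 x); apply: ger_powR; first by rewrite x0.
    by rewrite subr_ge0.
  apply: (@le_trans _ _ (x `^ (n.+1%:R - 1))); last by rewrite lerDr.
  by rewrite ler_powR ?(ltW x1)// lerD2r.
rewrite /laplace.
under eq_integral do rewrite mulrDr EFinD.
rewrite ge0_integralD//=; try (apply: measurable_laplace_integrand; exact: measurable_powker).
- by rewrite -/(laplace _ _) -/(laplace _ _) Gammae1 Gammae_nat -EFinD ltry.
- by move=> x _; rewrite lee_fin mulr_ge0 ?expR_ge0// powker_ge0.
- by move=> x _; rewrite lee_fin mulr_ge0 ?expR_ge0// powker_ge0.
Qed.

Lemma GammaE a : 0 < a -> (Gamma a)%:E = Gammae a.
Proof.
move=> a0.
have -> : Gamma a = fine (Gammae a).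
  rewrite /Gamma /Rintegral integral_mkcond; congr fine; apply: eq_integral => x _.
  rewrite patchE mem_setE/= in_itv/= andbT /powker mul1r mulrC.
  by case: ifPn => _; rewrite ?mulr0.
by rewrite fineK// ge0_fin_numE ?Gammae_lty// laplace_ge0//; exact: powker_ge0.
Qed.

(** Restricting the integral to [x > c], where [x^a >= c^a].  As [c] is arbitrary,
Gamma grows faster than any geometric sequence. *)
Lemma Gamma_lower a c : 0 <= a -> 0 <= c ->
  c `^ a * expR (- c) <= Gamma (a + 1).
Proof.
move=> a0 c0; rewrite -lee_fin GammaE ?ltr_pwDr//.
have mp : measurable_fun setT (fun x : R => powker 1 (x - c)).
  by apply: (measurableT_comp (measurable_powker 1)); exact: measurable_funB.
apply: (@le_trans _ _ (laplace (fun x => c `^ a * powker 1 (x - c)) 1)).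
  rewrite /laplace (@ge0_integral_affine _ 1 c)//; last 2 first.
  - apply: measurable_laplace_integrand; apply: measurable_funM => //.
  - by move=> x; rewrite lee_fin !mulr_ge0 ?expR_ge0 ?powR_ge0 ?powker_ge0.
  rewrite mul1e.
  under eq_integral.
    move=> x _; rewrite !mul1r addrK opprD expRD.
    rewrite (_ : _ * _ * _ = c `^ a * expR (- c) * (expR (- (1 * x)) * powker 1 x)); last first.
      by rewrite mul1r; ring.
    rewrite EFinM; over.
  rewrite ge0_integralZl//.
  - by rewrite -/(laplace _ _) Gammae1 mule1.
  - apply: measurable_laplace_integrand; exact: measurable_powker.
  - by move=> x _; rewrite lee_fin mulr_ge0 ?expR_ge0// powker_ge0.
  - by rewrite lee_fin mulr_ge0 ?expR_ge0// powR_ge0.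
apply: laplace_mono.
- by apply: measurable_funM.
- exact: measurable_powker.
- move=> x; rewrite mulr_ge0 ?powR_ge0 ?powker_ge0//=.
  have [xc|xc] := ltP 0 (x - c); last by rewrite powker_le0 ?mulr0 ?powker_ge0.
  have x0 : 0 < x by rewrite (le_lt_trans c0)// -subr_gt0.
  rewrite !powkerE// subrr powRr0 mulr1 addrK.
  by apply: ge0_ler_powR; rewrite ?nnegrE// ?ltW// -subr_gt0.
Qed.

Lemma GammaS a : 0 < a -> Gamma (a + 1) = a * Gamma a.
Proof.
move=> a0; apply: EFin_inj; rewrite EFinM (GammaE a0) -GammaeS//.
by apply: GammaE; rewrite addr_gt0.
Qed.

Lemma Gamma_gt0 a : 0 < a -> 0 < Gamma a.
Proof.
move=> a0; rewrite -(pmulr_rgt0 _ a0) -GammaS//.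
apply: lt_le_trans (Gamma_lower (ltW a0) (@ler01 R)).
by rewrite powR1 mul1r expR_gt0.
Qed.

Lemma Gamma_nat n : Gamma (n.+1%:R : R) = n`!%:R.
Proof. by apply: EFin_inj; rewrite -Gammae_nat GammaE. Qed.

Lemma laplace_powkerE a s : 0 < a -> 0 < s ->
  laplace (powker a) s = (Gamma a * s `^ (- a))%:E.
Proof. by move=> a0 s0; rewrite laplace_powker// -GammaE// -EFinM mulrC. Qed.

(** Euler's Beta integral. *)
Lemma convol_powkerE a b t : 0 < a -> 0 < b ->
  convol (powker a) (powker b) t =
  (Gamma a * Gamma b / Gamma (a + b) * powker (a + b) t)%:E.
Proof.
move=> a0 b0; rewrite convol_powker muleC.
have ab0 := addr_gt0 a0 b0.
have := Gammae_mul a b; rewrite -(GammaE a0) -(GammaE b0) -(GammaE ab0).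
have := Gamma_gt0 ab0; set G := Gamma (a + b) => G0.
have : (0 <= convol (powker a) (powker b) 1)%E.
  by apply: integral_ge0 => y _; rewrite lee_fin mulr_ge0// powker_ge0.
case: (convol _ _ 1) => //= [r _|_].
  by rewrite -!EFinM => -[->]; rewrite mulfK ?gt_eqF.
by rewrite gt0_mulye ?lte_fin.
Qed.

End gamma.

(** * Injectivity of the Laplace transform *)
Section step_kernel.
Context {R : realType}.
Implicit Types (u v : R).

Lemma bernoulli_lower v (n : nat) : 0 <= v <= 1 -> 1 - n%:R * v <= (1 - v) ^+ n.
Proof.
move=> /andP[v0 v1]; elim: n => [|n IH]; first by rewrite mul0r subr0 expr0.
rewrite exprS; apply: (@le_trans _ _ ((1 - v) * (1 - n%:R * v))).
  rewrite -natr1 -subr_ge0.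
  rewrite (_ : _ - _ = n%:R * v ^+ 2); last by ring.
  by rewrite mulr_ge0// sqr_ge0.
by rewrite ler_wpM2l// subr_ge0.
Qed.

(** With [u = exp (- c x)], the powers [(1 - u^n)^(2^n)] converge to the indicator
of [u < 1/2], that is, of [x > t] when [c = ln 2 / t].  They are polynomials in
[u], which is how an indicator is reached from Laplace transforms. *)
Lemma step_kernel_cvg1 u : 0 < u -> 2 * u < 1 ->
  (1 - u ^+ n) ^+ (2 ^ n) @[n --> \oo] --> (1 : R).
Proof.
move=> u0 u1; have u2 : u <= 1 by lra.
have H : (1 : R) - (2 * u) ^+ n @[n --> \oo] --> (1 : R).
  rewrite -[X in _ --> X]subr0; apply: cvgB; first exact: cvg_cst.
  by apply: cvg_expr; rewrite ger0_norm// mulr_ge0// ltW.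
apply: (@squeeze_cvgr _ _ _ _ (fun n => 1 - (2 * u) ^+ n) (cst 1)) => //; last exact: cvg_cst.
near=> n; apply/andP; split.
  rewrite exprMn -natrX; apply: bernoulli_lower.
  by rewrite exprn_ge0 ?(ltW u0)//= exprn_ile1// ltW.
apply: exprn_ile1.
  by rewrite subr_ge0 exprn_ile1// ltW.
by rewrite gerBl exprn_ge0// ltW.
Unshelve. all: by end_near. Qed.

Lemma step_kernel_cvg0 u : 0 < u < 1 -> 1 < 2 * u ->
  (1 - u ^+ n) ^+ (2 ^ n) @[n --> \oo] --> (0 : R).
Proof.
move=> /andP[u0 u1] u2.
have H : ((2 * u)^-1) ^+ n @[n --> \oo] --> (0 : R).
  apply: cvg_expr; rewrite ger0_norm ?invr_ge0 ?mulr_ge0 ?ltW//.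
  by rewrite invf_lt1// (lt_trans ltr01).
apply: (@squeeze_cvgr _ _ _ _ (cst 0) (fun n => ((2 * u)^-1) ^+ n)) => //; last exact: cvg_cst.
near=> n; apply/andP; split.
  by rewrite exprn_ge0// subr_ge0 exprn_ile1// ltW.
apply: (@le_trans _ _ (expR (- (u ^+ n)) ^+ (2 ^ n))).
  rewrite ler_pXn2r ?nnegrE ?expR_ge0//; last 2 first.
    by rewrite expn_gt0.
    by rewrite subr_ge0 exprn_ile1// ltW.
  exact: expR_ge1Dx.
rewrite -expRM_natl mulrN expRN natrX -exprMn exprVn lef_pV2 ?posrE ?expR_gt0//; last first.
  by rewrite exprn_gt0// mulr_gt0.
apply: le_trans (expR_ge1Dx _); by rewrite lerDr.
Unshelve. all: by end_near. Qed.

End step_kernel.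

Section laplace_injective.
Context {R : realType}.
Local Notation mu := (@lebesgue_measure R).
Implicit Types (a b c s t x : R) (g h : R -> R).

(** Finiteness is included because the argument subtracts transforms. *)
Definition laplace_eq g h : Prop :=
  forall s, 0 < s -> laplace g s = laplace h s /\ (laplace g s < +oo)%E.

Definition positive_part_only g : Prop :=
  [/\ measurable_fun setT g, forall x, 0 <= g x & forall x, x <= 0 -> g x = 0].

Lemma measurable_expRNM g : measurable_fun setT g ->
  measurable_fun setT (fun x => (expR (- x) * g x)%:E).
Proof.
move=> mg; have := @measurable_laplace_integrand _ g 1 mg.
by apply: eq_measurable_fun => x _; rewrite mul1r.
Qed.

Lemma positive_part_onlyM c g : 0 <= c -> positive_part_only g ->
  positive_part_only (fun x => (1 - expR (- (c * x))) * g x).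
Proof.
move=> c0 [mg g0 gn]; split.
- apply: measurable_funM mg; apply: measurable_funB => //.
  exact: measurable_expRN.
- move=> x; have [x0|x0] := leP x 0; first by rewrite gn// mulr0.
  by rewrite mulr_ge0// subr_ge0 expR_le1 oppr_le0 mulr_ge0// ltW.
- by move=> x x0; rewrite gn// mulr0.
Qed.

Lemma laplace_split c g s : 0 <= c -> positive_part_only g ->
  (laplace g s = laplace (fun x => (1 - expR (- (c * x))) * g x)%R s
    + laplace g (s + c))%E.
Proof.
move=> c0 pg; have [mh h0 _] := positive_part_onlyM c0 pg.
case: pg => mg g0 _.
rewrite /laplace -ge0_integralD//.
- apply: eq_integral => x _; rewrite -EFinD; congr EFin.
  by rewrite [(s + c) * x]mulrDl opprD expRD; ring.
- by move=> x _; rewrite lee_fin mulr_ge0 ?expR_ge0.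
- exact: measurable_laplace_integrand.
- by move=> x _; rewrite lee_fin mulr_ge0 ?expR_ge0.
- exact: measurable_laplace_integrand.
Qed.

(** Multiplication by [exp (- c x)] shifts the argument of the transform. *)
Lemma laplace_eqM c g h : 0 <= c -> positive_part_only g -> positive_part_only h ->
  laplace_eq g h ->
  laplace_eq (fun x => (1 - expR (- (c * x))) * g x)
             (fun x => (1 - expR (- (c * x))) * h x).
Proof.
move=> c0 pg ph gh s s0.
have [_ g0 _] := positive_part_onlyM c0 pg.
have [_ h0 _] := positive_part_onlyM c0 ph.
have [E1 F1] := gh s s0; have [E2 F2] := gh (s + c) (ltr_pwDl s0 c0).
have lg := laplace_ge0 s g0; have lh := laplace_ge0 s h0.
have l2 : (0 <= laplace g (s + c))%E by apply: laplace_ge0; case: pg.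
move: E1 F1 F2; rewrite (laplace_split s c0 pg) (laplace_split s c0 ph) -E2.
move: lg lh l2; case: (laplace g (s + c)) => [r| |]//.
case: (laplace _ s) => [p| |]//; case: (laplace _ s) => [q| |]//.
move=> _ _ _ [] /addIr -> _ _; split => //; exact: ltry.
Qed.

Lemma laplace_eqX c n g h : 0 <= c -> positive_part_only g -> positive_part_only h ->
  laplace_eq g h ->
  laplace_eq (fun x => (1 - expR (- (c * x))) ^+ n * g x)
             (fun x => (1 - expR (- (c * x))) ^+ n * h x).
Proof.
move=> c0 pg ph gh.
pose F k (f : R -> R) x := (1 - expR (- (c * x))) ^+ k * f x.
have FS k f : F k.+1 f = (fun x => (1 - expR (- (c * x))) * F k f x).
  by apply/funext => x; rewrite /F exprS mulrA.
have F0 f : F 0%N f = f by apply/funext => x; rewrite /F expr0 mul1r.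
suff [] : [/\ laplace_eq (F n g) (F n h), positive_part_only (F n g)
           & positive_part_only (F n h)] by [].
elim: n => [|n [IH1 IH2 IH3]]; first by rewrite !F0.
by rewrite !FS; split; [exact: laplace_eqM| exact: positive_part_onlyM..].
Qed.

Lemma laplace_tail_cvg g t : 0 < t -> positive_part_only g -> (laplace g 1 < +oo)%E ->
  (laplace (fun x => (1 - expR (- (n%:R * (ln 2 / t) * x))) ^+ (2 ^ n) * g x)%R 1
    @[n --> \oo] --> \int[mu]_(x in `]t, +oo[) (expR (- x) * g x)%:E)%E.
Proof.
move=> t0 [mg g0 gn] gfin.
rewrite integral_mkcond.
have ln2 : 0 < ln 2 :> R by rewrite ln_gt0// ltr1n.
have uE n x : expR (- (n%:R * (ln 2 / t) * x)) = expR (- (ln 2 / t * x)) ^+ n.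
  by rewrite -expRM_natl; congr expR; ring.
have mk n : measurable_fun setT
    (fun x => (1 - expR (- (n%:R * (ln 2 / t) * x))) ^+ (2 ^ n) * g x).
  apply: measurable_funM mg; apply: measurable_funX; apply: measurable_funB => //.
  exact: measurable_expRN.
have cvgK x : x != t -> (expR (- (1 * x)) *
      ((1 - expR (- (n%:R * (ln 2 / t) * x))) ^+ (2 ^ n) * g x))%:E @[n --> \oo] -->
    ((fun x => (expR (- x) * g x)%:E) \_ `]t, +oo[) x.
  move=> xt; have [x0|x0] := leP x 0.
    rewrite patchE mem_setE/= in_itv/= andbT ltNge (le_trans x0 (ltW t0))/=.
    by under eq_fun do rewrite gn// !mulr0; exact: cvg_cst.
  under eq_fun do rewrite uE mul1r.
  set u := expR (- (ln 2 / t * x)).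
  have u1 : 0 < u < 1 by rewrite expR_gt0 expR_lt1 oppr_lt0 !mulr_gt0// invr_gt0.
  have u2E : 2 * u = expR (ln 2 * (1 - x / t)).
    rewrite mulrBr mulr1 expRD lnK ?posrE//; congr (_ * expR _); field.
    by rewrite gt_eqF.
  rewrite patchE mem_setE/= in_itv/= andbT; case: ifPn => [tx|].
    apply: cvg_EFin; first exact: nearW.
    apply: cvgMr; rewrite -[X in _ --> X]mul1r; apply: cvgMl.
    apply: step_kernel_cvg1; first by case/andP: u1.
    rewrite u2E expR_lt1 pmulr_rlt0// subr_lt0 ltr_pdivlMr// mul1r//.
  rewrite -leNgt le_eqVlt (negbTE xt)/= => {}xt.
  rewrite (_ : point = (expR (- x) * (0 * g x))%:E); last by rewrite mul0r mulr0.
  apply: cvg_EFin; first exact: nearW.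
  apply: cvgMr; apply: cvgMl; apply: step_kernel_cvg0 => //.
  by rewrite u2E expR_gt1 pmulr_rgt0// subr_gt0 ltr_pdivrMr// mul1r.
have := @dominated_convergence _ _ _ mu setT measurableT
  (fun n x => (expR (- (1 * x)) *
      ((1 - expR (- (n%:R * (ln 2 / t) * x))) ^+ (2 ^ n) * g x))%:E)
  ((fun x => (expR (- x) * g x)%:E) \_ `]t, +oo[)
  (fun x => (expR (- (1 * x)) * g x)%:E).
case => //.
- by move=> n; exact: measurable_laplace_integrand.
- apply/(measurable_restrictT _ (measurable_itv _)).
  by apply: (@measurable_funS _ _ _ _ setT) => //; exact: measurable_expRNM.
- exists [set t]; split => //; first exact: lebesgue_measure_set1.
  move=> x/=; apply: contra_notP => xt _; apply: cvgK; exact/eqP.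
- apply/integrableP; split; first exact: measurable_laplace_integrand.
  apply: le_lt_trans gfin; apply: ge0_le_integral => //.
  + by apply: measurableT_comp => //; exact: measurable_laplace_integrand.
  + exact: measurable_laplace_integrand.
  + by move=> x _; rewrite /= lee_fin ger0_norm// mulr_ge0// expR_ge0.
- apply: aeW => x n _; have [x0|x0] := leP x 0; first by rewrite /= gn// !mulr0 normr0.
  have k01 : 0 <= 1 - expR (- (n%:R * (ln 2 / t) * x)) <= 1.
    rewrite subr_ge0 gerBl expR_ge0 expR_le1 oppr_le0 andbT.
    by rewrite !mulr_ge0// ?invr_ge0 ltW.
  rewrite /= lee_fin ger0_norm; last first.
    by rewrite !mulr_ge0 ?expR_ge0// exprn_ge0//; case/andP: k01.
  rewrite ler_wpM2l ?expR_ge0// ler_piMl// exprn_ile1//; by case/andP: k01.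
Qed.

Lemma laplace_eq_tail g h t : 0 < t ->
  positive_part_only g -> positive_part_only h -> laplace_eq g h ->
  (\int[mu]_(x in `]t, +oo[) (expR (- x) * g x)%:E =
   \int[mu]_(x in `]t, +oo[) (expR (- x) * h x)%:E)%E.
Proof.
move=> t0 pg ph gh; have [g1 gfin] := gh 1 ltr01.
have cg := laplace_tail_cvg t0 pg gfin.
rewrite g1 in gfin; have ch := laplace_tail_cvg t0 ph gfin.
rewrite -(cvg_lim _ cg)// -(cvg_lim _ ch)//; congr (limn _).
apply/funext => n; have c0 : 0 <= n%:R * (ln 2 / t).
  by rewrite mulr_ge0// divr_ge0 ?(ltW t0)// ln_ge0// ler1n.
by have [] := laplace_eqX (2 ^ n) c0 pg ph gh ltr01.
Qed.

Lemma laplace_tail_fin g t : positive_part_only g -> (laplace g 1 < +oo)%E ->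
  (\int[mu]_(x in `]t, +oo[) (expR (- x) * g x)%:E < +oo)%E.
Proof.
move=> [mg g0 _]; apply: le_lt_trans; rewrite /laplace.
under [leRHS]eq_integral do rewrite mul1r.
apply: ge0_subset_integral => //.
- have := @measurable_laplace_integrand _ g 1 mg.
  by apply: eq_measurable_fun => x _; rewrite mul1r.
- by move=> x _; rewrite lee_fin mulr_ge0 ?expR_ge0.
Qed.

Lemma laplace_eq_itv g h a b : 0 < a -> a < b ->
  positive_part_only g -> positive_part_only h -> laplace_eq g h ->
  (\int[mu]_(x in `]a, b]) (expR (- x) * g x)%:E =
   \int[mu]_(x in `]a, b]) (expR (- x) * h x)%:E)%E.
Proof.
move=> a0 ab pg ph gh; have [g1 gfin] := gh 1 ltr01.
have b0 := lt_trans a0 ab.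
have split f : positive_part_only f ->
    (\int[mu]_(x in `]a, +oo[) (expR (- x) * f x)%:E =
     \int[mu]_(x in `]a, b]) (expR (- x) * f x)%:E +
     \int[mu]_(x in `]b, +oo[) (expR (- x) * f x)%:E)%E.
  move=> [mf f0 _]; rewrite -ge0_integral_setU//=.
  - congr (integral _ _ _); apply/seteqP; split=> x /=; rewrite !in_itv/= !andbT.
      by move=> ->/=; have [xb|xb] := leP x b; [left|right].
    by case=> [/andP[]//|]; exact: lt_trans.
  - have := @measurable_laplace_integrand _ f 1 mf.
    move=> H; apply: (@measurable_funS _ _ _ _ setT) => //.
    by apply: eq_measurable_fun H => x _; rewrite mul1r.
  - by move=> x _; rewrite lee_fin mulr_ge0 ?expR_ge0.
  - apply/disj_setPS => x /= []; rewrite !in_itv/= andbT => /andP[_].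
    by rewrite leNgt => /negP.
have := laplace_eq_tail a0 pg ph gh.
rewrite (split g pg) (split h ph) (laplace_eq_tail b0 pg ph gh).
have : (\int[mu]_(x in `]b, +oo[) (expR (- x) * h x)%:E \is a fin_num)%E.
  rewrite ge0_fin_numE.
    by apply: laplace_tail_fin => //; rewrite -g1.
  by apply: integral_ge0 => x _; rewrite lee_fin mulr_ge0 ?expR_ge0//; case: ph.
by move=> fin /(congr1 (fun z => z - \int[mu]_(x in `]b, +oo[) (expR (- x) * h x)%:E)%E);
  rewrite !addeK.
Qed.

(** Both functions have the same mass on [[a, b]] for the weight [exp (- x)], while
monotonicity bounds it below by [g a] and above by [h b]. *)
Lemma laplace_eq_le g h a b : 0 < a -> a < b ->
  positive_part_only g -> positive_part_only h -> laplace_eq g h ->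
  {in `]0, +oo[ &, {homo g : x y / x <= y}} ->
  {in `]0, +oo[ &, {homo h : x y / x <= y}} ->
  g a <= h b.
Proof.
move=> a0 ab pg ph gh ndg ndh.
have b0 := lt_trans a0 ab.
pose w : \bar R := (\int[mu]_(x in `]a, b]) (expR (- x))%:E)%E.
have mE : measurable_fun (`]a, b] : set R) (fun x => (expR (- x))%:E).
  apply: (@measurable_funS _ _ _ _ setT) => //; apply/measurable_EFinP.
  by apply: measurableT_comp => //; exact: measurable_funN.
have mEf f : positive_part_only f ->
    measurable_fun (`]a, b] : set R) (fun x => (expR (- x) * f x)%:E).
  move=> [mf _ _]; apply: (@measurable_funS _ _ _ _ setT) => //.
  have := @measurable_laplace_integrand _ f 1 mf.
  by apply: eq_measurable_fun => x _; rewrite mul1r.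
have wlow : ((expR (- b) * (b - a))%:E <= w)%E.
  apply: (@le_trans _ _ (\int[mu]_(x in `]a, b]) (expR (- b))%:E)%E).
    rewrite integral_cst//= lebesgue_measure_itv/= lte_fin ab -EFinB -EFinM.
    by [].
  apply: ge0_le_integral => //.
  by move=> x; rewrite /= in_itv/= => /andP[_ xb]; rewrite lee_fin ler_expR lerN2.
have wup : (w <= (b - a)%:E)%E.
  apply: (@le_trans _ _ (\int[mu]_(x in `]a, b]) 1%:E)%E).
    apply: ge0_le_integral => //.
    move=> x; rewrite /= in_itv/= => /andP[ax _]; rewrite lee_fin expR_le1 oppr_le0.
    by rewrite ltW// (lt_trans a0).
  by rewrite integral_cst//= lebesgue_measure_itv/= lte_fin ab -EFinB -EFinM mul1r.
have [g0 h0] : (0 <= g a) /\ (0 <= h b) by case: pg ph => _ + _ [_ + _].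
have gw : ((g a)%:E * w <= \int[mu]_(x in `]a, b]) (expR (- x) * g x)%:E)%E.
  rewrite /w -ge0_integralZl//.
  apply: ge0_le_integral => //.
  - by move=> x _; rewrite -EFinM lee_fin mulr_ge0 ?expR_ge0.
  - by apply: measurable_funeM.
  - exact: mEf.
  - move=> x; rewrite /= in_itv/= => /andP[ax _].
    rewrite -EFinM lee_fin mulrC ler_wpM2l ?expR_ge0// ndg// ?ltW// in_itv/= ?a0//.
    by rewrite (lt_trans a0).
have hw : (\int[mu]_(x in `]a, b]) (expR (- x) * h x)%:E <= (h b)%:E * w)%E.
  rewrite /w -ge0_integralZl//.
  apply: ge0_le_integral => //.
  - by move=> x _; rewrite lee_fin mulr_ge0 ?expR_ge0//; case: ph.
  - exact: mEf.
  - by apply: measurable_funeM.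
  - move=> x; rewrite /= in_itv/= => /andP[ax xb].
    rewrite -EFinM lee_fin [leRHS]mulrC ler_wpM2l ?expR_ge0// ndh// in_itv/= ?b0//.
    by rewrite (lt_trans a0).
rewrite (laplace_eq_itv a0 ab pg ph gh) in gw.
move: (le_trans gw hw) wlow wup; case: w {gw hw} => [w| |]//.
rewrite -!EFinM !lee_fin => gwh wlow _.
have w0 : 0 < w by apply: lt_le_trans wlow; rewrite mulr_gt0 ?expR_gt0// subr_gt0.
by rewrite -(ler_pM2r w0).
Qed.

(** Monotone functions with the same transform can differ only at their jumps. *)
Lemma laplace_inj g h t : 0 < t ->
  positive_part_only g -> positive_part_only h -> laplace_eq g h ->
  {in `]0, +oo[ &, {homo g : x y / x <= y}} ->
  {in `]0, +oo[ &, {homo h : x y / x <= y}} ->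
  {for t, continuous h} -> g t = h t.
Proof.
move=> t0 pg ph gh ndg ndh ch.
have hg : laplace_eq h g by move=> s s0; have [-> ?] := gh s s0.
apply/eqP; rewrite eq_le; apply/andP; split; rewrite leNgt; apply/negP => lt_gh.
- have /nbhs_ballP[e /= e0 He] : \forall x \near t, h x < g t by exact: (cvgr_lt (h t) ch).
  have : h (t + e / 2) < g t.
    by apply: He; rewrite /ball/= opprD addrA subrr sub0r normrN ger0_norm; lra.
  by apply/negP; rewrite -leNgt; apply: laplace_eq_le => //; lra.
- have /nbhs_ballP[e /= e0 He] : \forall x \near t, g t < h x by exact: (cvgr_gt (h t) ch).
  have m0 : 0 < Num.min (e / 2) (t / 2) by rewrite lt_min; lra.
  have m1 : Num.min (e / 2) (t / 2) <= e / 2 by rewrite ge_min lexx.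
  have m2 : Num.min (e / 2) (t / 2) <= t / 2 by rewrite ge_min lexx orbT.
  have : g t < h (t - Num.min (e / 2) (t / 2)).
    by apply: He; rewrite /ball/= opprB addrC subrK ger0_norm; lra.
  by apply/negP; rewrite -leNgt; apply: laplace_eq_le => //; lra.
Qed.

End laplace_injective.

(** * Approximation of times from the right *)
Section right_grid.
Context {R : realType}.
Implicit Types (x y : R) (n j : nat).

(** Cells of length [1 / (n + 1)]; [grid_point n j] is the right end of the cell [j],
so that the grid point of a time lies strictly after it and right-continuity of
the paths applies. *)
Definition grid_index n x : nat := Num.truncn (n.+1%:R * x).

Definition grid_point n j : R := j.+1%:R / n.+1%:R.

Lemma grid_point_ge0 n j : 0 <= grid_point n j.
Proof. by rewrite divr_ge0. Qed.

Lemma measurable_grid_index n j : measurable [set x | grid_index n x = j].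
Proof.
have mle i : measurable [set x | (grid_index n x <= i)%N].
  have mf : measurable_fun setT (fun x : R => n.+1%:R * x) by exact: measurable_funM.
  rewrite (_ : mkset _ = setT `&` (fun x : R => n.+1%:R * x) @^-1` `]-oo, i.+1%:R[).
    exact: mf.
  by apply/seteqP; split=> x /=; rewrite in_itv/= /grid_index truncn_le_nat// => -[].
case: j => [|j].
  rewrite (_ : mkset _ = [set x | (grid_index n x <= 0)%N]); first exact: mle.
  by apply/seteqP; split=> x /=; [move=> ->|rewrite leqn0 => /eqP].
rewrite (_ : mkset _ = [set x | (grid_index n x <= j.+1)%N] `\`
    [set x | (grid_index n x <= j)%N]); first by apply: measurableD; exact: mle.
apply/seteqP; split=> x /=; first by move=> ->; split => //; rewrite ltnn.
by move=> [xj /negP]; rewrite -ltnNge => jx; apply/eqP; rewrite eqn_leq xj jx.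
Qed.

Lemma grid_point_gt n x : x < grid_point n (grid_index n x).
Proof. by rewrite /grid_point ltr_pdivlMr// mulrC; exact: truncnS_gt. Qed.

Lemma grid_point_le n x : 0 <= x ->
  grid_point n (grid_index n x) <= x + n.+1%:R^-1.
Proof.
move=> x0; rewrite /grid_point ler_pdivrMr// mulrDl mulVf// -natr1 lerD2r mulrC.
by have /andP[] := @truncn_itv R (n.+1%:R * x) (mulr_ge0 (ler0n _ _) x0).
Qed.

Lemma grid_point_cvg x (y : nat -> R) : 0 <= x -> (forall n, x <= y n) ->
  y n @[n --> \oo] --> x ->
  grid_point n (grid_index n (y n)) @[n --> \oo] --> x.
Proof.
move=> x0 xy yx; apply: (@squeeze_cvgr _ _ _ _ (cst x) (fun n => y n + n.+1%:R^-1)).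
- apply: nearW => n; rewrite grid_point_le ?(le_trans x0)// andbT.
  by rewrite ltW// (le_lt_trans (xy n))// grid_point_gt.
- exact: cvg_cst.
- rewrite -[X in _ --> X]addr0; apply: cvgD => //.
  exact: cvg_harmonic.
Qed.

End right_grid.

Section joint_measurability.
Context d (T : measurableType d) {R : realType}.
Implicit Types X : R -> T -> R.

Lemma right_continuous_approx (x : R -> R) t (y : nat -> R) :
  cadlag x -> 0 <= t -> (forall n, t <= y n) -> y n @[n --> \oo] --> t ->
  x (grid_point n (grid_index n (y n))) @[n --> \oo] --> x t.
Proof.
move=> [rc _] t0 ty yt; have /cvg_at_rightP := rc _ t0; apply; split.
  by move=> n; rewrite (le_lt_trans (ty n))// grid_point_gt.
exact: grid_point_cvg.
Qed.

(** The process sampled at the grid point of the cell of the time is piecewise a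
fixed random variable; by right-continuity it converges to the process.  Only the
times [t >= 0] matter, hence the maximum. *)
Lemma measurable_process X :
  (forall t, 0 <= t -> measurable_fun setT (X t)) ->
  (forall w, cadlag (X ^~ w)) ->
  measurable_fun setT (fun z : R * T => X (Num.max 0 z.1) z.2).
Proof.
move=> mX cX.
pose Xn n (z : R * T) := X (grid_point n (grid_index n (Num.max 0 z.1))) z.2.
apply: (@measurable_fun_cvg _ _ _ _ Xn); last first.
  move=> z _; have z0 : 0 <= Num.max 0 z.1 by rewrite le_max lexx.
  exact: (@right_continuous_approx (X ^~ z.2) (Num.max 0 z.1)
    (cst (Num.max 0 z.1)) (cX z.2) z0 (fun=> lexx _) (cvg_cst _)).
move=> n.
pose E j : set (R * T) := [set z | grid_index n (Num.max 0 z.1) = j].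
have -> : [set: R * T] = \bigcup_j E j.
  by apply/seteqP; split=> z // _; exists (grid_index n (Num.max 0 z.1)).
have mm : measurable_fun setT (fun z : R * T => Num.max 0 z.1).
  by apply: measurable_maxr.
have mE j : measurable (E j).
  have := mm measurableT _ (measurable_grid_index n j).
  by rewrite setTI.
apply/measurable_fun_bigcup => // j.
apply: (@eq_measurable_fun _ _ _ _ _ (fun z => X (grid_point n j) z.2)).
  by move=> z; rewrite inE /Xn => ->.
apply: (@measurable_funS _ _ _ _ setT) => //.
apply: (measurableT_comp (mX _ (grid_point_ge0 n j))) => //.
Qed.

Lemma measurable_process_comp X (Z : T -> R) :
  (forall t, 0 <= t -> measurable_fun setT (X t)) ->
  (forall w, cadlag (X ^~ w)) ->
  measurable_fun setT Z -> (forall w, 0 <= Z w) ->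
  measurable_fun setT (fun w => X (Z w) w).
Proof.
move=> mX cX mZ Z0.
have mp : measurable_fun setT (fun w => (Z w, w)) by exact: measurable_fun_pair.
apply: eq_measurable_fun (measurableT_comp (measurable_process mX cX) mp) => w _.
by rewrite /= max_r.
Qed.

End joint_measurability.

(** * Moments of the inverse stable subordinator *)
Section inverse_process.
Context d (T : measurableType d) {R : realType} (P : probability T R).
Variables (alpha : R) (D : R -> T -> R).
Hypothesis alpha0 : 0 < alpha.
Hypothesis subD : subordinator P (fun s => s `^ alpha) D.
Local Notation mu := (@lebesgue_measure R).
Implicit Types (b s t x : R) (w : T).

Let mD t : 0 <= t -> measurable_fun setT (D t).
Proof. by case: subD => -[h _ _ _] _ _; exact: h. Qed.

Let D_homo w s t : 0 <= s -> s <= t -> D s w <= D t w.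
Proof. by case: subD => _ h _; exact: h. Qed.

Let D_ge0 w t : 0 <= t -> 0 <= D t w.
Proof. by case: subD => -[_ D0 _ _] _ _ t0; rewrite -(D0 w) D_homo. Qed.

Let D_laplace s t : 0 <= s -> 0 <= t ->
  (\int[P]_w (expR (- (s * D t w)))%:E = (expR (- (t * s `^ alpha)))%:E)%E.
Proof. by case: subD => _ _ h s0 t0; have := h s t s0 t0; rewrite unlock. Qed.

Let Y := inverse_process D.

Definition passage_times t w := [set x | 0 <= x /\ t < D x w].

Lemma passage_times_lbound t w : lbound (passage_times t w) 0.
Proof. by move=> x []. Qed.

Lemma inverse_process_ge0 t w : 0 <= Y t w.
Proof.
have [E|E] := eqVneq (passage_times t w) set0.
  by rewrite /Y /inverse_process -/(passage_times t w) E inf0.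
by apply: lb_le_inf; [exact/set0P|exact: passage_times_lbound].
Qed.

Lemma lt_inverse_process t w x : 0 <= x -> x < Y t w -> D x w <= t.
Proof.
move=> x0 xY; rewrite leNgt; apply/negP => tD; move: xY; apply/negP; rewrite -leNgt.
by apply: ge_inf; [exists 0; exact: passage_times_lbound|split].
Qed.

Lemma inverse_process_ge t w x : passage_times t w !=set0 -> 0 <= x ->
  D x w <= t -> x <= Y t w.
Proof.
move=> ne x0 Dt; apply: lb_le_inf => // y [y0 tD].
rewrite leNgt; apply/negP => yx; have := D_homo w y0 (ltW yx).
by rewrite leNgt => /negP; apply; rewrite (le_lt_trans Dt).
Qed.

Lemma measurable_le_D t x : 0 <= x -> measurable [set w | D x w <= t].
Proof.
move=> x0; have := mD x0 measurableT (measurable_itv `]-oo, t]).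
by rewrite setTI; congr measurable; apply/seteqP; split=> w /=; rewrite in_itv.
Qed.

Lemma measurable_passage_empty t : measurable [set w | passage_times t w = set0].
Proof.
rewrite (_ : mkset _ = \bigcap_n [set w | D n%:R w <= t]).
  by apply: bigcap_measurable => // n _; exact: measurable_le_D.
apply/seteqP; split=> w /=.
  move=> E n _ /=; rewrite leNgt; apply/negP => tD.
  by have : passage_times t w n%:R by []; rewrite E.
move=> H; rewrite -subset0 => x [x0 tD].
have := H (Num.truncn x).+1 I; rewrite /= leNgt => /negP; apply.
by apply: lt_le_trans tD _; rewrite D_homo// ltW// truncnS_gt.
Qed.

(** If [D] ever exceeds [t], monotonicity makes [Y t < x] equivalent to [D] exceeding
[t] at some grid point before [x]; otherwise the infimum of the empty set gives
[Y t = 0]. *)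
Lemma measurable_inverse_process t : measurable_fun setT (Y t).
Proof.
move=> mT; apply: (measurability _ (RGenInftyO.measurableE R)) => //.
move=> _ [_ [x ->] <-]; rewrite setTI.
have [x0|x0] := leP x 0.
  rewrite (_ : _ @^-1` _ = set0)//; apply/seteqP; split=> w //=.
  by rewrite in_itv/= ltNge (le_trans x0)// inverse_process_ge0.
rewrite (_ : _ @^-1` _ = [set w | passage_times t w = set0] `|`
  \bigcup_n \bigcup_j
    if grid_point n j < x then ~` [set w | D (grid_point n j) w <= t] else set0).
  apply: measurableU; first exact: measurable_passage_empty.
  apply: bigcupT_measurable => n; apply: bigcupT_measurable => j.
  case: ifP => // _; apply: measurableC; apply: measurable_le_D.
  exact: grid_point_ge0.
apply/seteqP; split=> w /=; rewrite in_itv/=.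
  have [E _|/set0P ne Yx] := eqVneq (passage_times t w) set0; [by left|right].
  have [y [y0 tD] yx] : exists2 y, passage_times t w y & y < x by exact: inf_lt.
  have xy0 : 0 < x - y by rewrite subr_gt0.
  have [n _ ny] := near_infty_natSinv_lt (PosNum xy0).
  exists n => //; exists (grid_index n y) => //.
  have -> : grid_point n (grid_index n y) < x.
    by rewrite (le_lt_trans (grid_point_le n y0))// -ltrBrDl; apply: (ny n) => /=.
  apply/negP; rewrite -ltNge (lt_le_trans tD)// D_homo//.
  exact/ltW/grid_point_gt.
case=> [E|[n _ [j _]]].
  by rewrite /Y /inverse_process -/(passage_times t w) E inf0.
case: ifP => // gx /negP; rewrite -ltNge => tD; apply: le_lt_trans gx.
apply: ge_inf; first by exists 0; exact: passage_times_lbound.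
by split => //; exact: grid_point_ge0.
Qed.

(** Markov's inequality for [exp (- D x)]. *)
Lemma prob_le_D t x : 0 <= x -> (P [set w | (D x w <= t)%R] <= (expR (t - x))%:E)%E.
Proof.
move=> x0.
have m1 := measurable_le_D t x0.
apply: (@le_trans _ _ (\int[P]_w (expR t * expR (- (1 * D x w)))%:E)%E); last first.
  under eq_integral do rewrite EFinM.
  rewrite ge0_integralZl//.
  - by rewrite D_laplace// powR1 mulr1 -EFinM -expRD.
  - apply/measurable_EFinP; apply: (measurableT_comp (measurable_expRN 1)).
    exact: mD.
rewrite -[X in P X]setIT -integral_indic//; apply: ge0_le_integral => //.
- exact/measurable_EFinP/measurable_indicP.
- apply/measurable_EFinP; apply: measurable_funM => //.
  by apply: (measurableT_comp (measurable_expRN 1)); exact: mD.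
- move=> w _; rewrite lee_fin indicE; case: (boolP (_ \in _)); rewrite ?mulr_ge0 ?expR_ge0//.
  by rewrite inE /= mul1r -expRD => Dt; rewrite -expR0 ler_expR; lra.
Qed.

(** On this event [D n <= t] for every [n], and [P (D n <= t) <= exp (t - n)]. *)
Lemma passage_empty_null t : P [set w | passage_times t w = set0] = 0%E.
Proof.
apply/eqP; rewrite eq_le measure_ge0 andbT.
have bound n : (P [set w | passage_times t w = set0] <= (expR (t - n%:R))%:E)%E.
  apply: le_trans (prob_le_D t (ler0n R n)); apply: le_measure.
  - by rewrite inE; exact: measurable_passage_empty.
  - by rewrite inE; exact: measurable_le_D.
  - move=> w /= E; rewrite leNgt; apply/negP => tD.
    by have : passage_times t w n%:R by []; rewrite E.
have := probability_le1 P (measurable_passage_empty t).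
move: bound; case: (P _) => [r| |]// bound _; rewrite lee_fin leNgt; apply/negP => r0.
have := bound (Num.truncn (expR t / r)); rewrite lee_fin expRD expRN.
set n := Num.truncn _; rewrite ler_pdivlMr ?expR_gt0// leNgt => /negP; apply.
rewrite -ltr_pdivrMl// mulrC (lt_le_trans (truncnS_gt _))// -/n.
by apply: le_trans (expR_ge1Dx _); rewrite -natr1 addrC.
Qed.

(** The indicator of [D x <= t]. *)
Let below t x w : R := if D (Num.max 0 x) w <= t then 1 else 0.

Let below_ge0 t x w : 0 <= below t x w.
Proof. by rewrite /below; case: ifP. Qed.

Let measurable_below : measurable_fun setT (fun z : (R * R) * T => below z.1.1 z.1.2 z.2).
Proof.
apply: measurable_fun_ifT => //; apply: measurable_fun_ler => //; last first.
  by apply: measurableT_comp.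
have cD w : cadlag (D ^~ w) by case: subD => -[].
have mp : measurable_fun setT (fun z : (R * R) * T => (z.1.2, z.2)).
  apply: measurable_fun_pair => //; exact: measurableT_comp.
exact: (measurableT_comp (measurable_process mD cD) mp).
Qed.

Let measurable_below_xw t : measurable_fun setT (fun z : R * T => below t z.1 z.2).
Proof.
have mp : measurable_fun setT (fun z : R * T => ((t, z.1), z.2)).
  by apply: measurable_fun_pair => //; exact: measurable_fun_pair.
exact: (measurableT_comp measurable_below mp).
Qed.

Let measurable_below_tw x : measurable_fun setT (fun z : R * T => below z.1 x z.2).
Proof.
have mp : measurable_fun setT (fun z : R * T => ((z.1, x), z.2)).
  by apply: measurable_fun_pair => //; exact: measurable_fun_pair.
exact: (measurableT_comp measurable_below mp).
Qed.

Let cdf t x : \bar R := (\int[P]_w (below t x w)%:E)%E.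

Let cdf_ge0 t x : (0 <= cdf t x)%E.
Proof. by apply: integral_ge0 => w _; rewrite lee_fin. Qed.

Let measurable_cdf : measurable_fun setT (fun z : R * R => cdf z.1 z.2).
Proof.
apply: (@measurable_tonelli _ _ _ _ R P (fun (z : R * R) w => (below z.1 z.2 w)%:E)).
  exact/measurable_EFinP.
by move=> *; rewrite lee_fin.
Qed.

Let measurable_cdf_x t : measurable_fun setT (cdf t).
Proof.
have mp : measurable_fun setT (fun x : R => (t, x)) by exact: measurable_fun_pair.
exact: (measurableT_comp measurable_cdf mp).
Qed.

Let measurable_cdf_t x : measurable_fun setT (cdf ^~ x).
Proof.
have mp : measurable_fun setT (fun t : R => (t, x)) by exact: measurable_fun_pair.
exact: (measurableT_comp measurable_cdf mp).
Qed.

Lemma ge0_eq_integral_but1 (c : R) (g h : R -> R) :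
  measurable_fun setT g -> measurable_fun setT h ->
  (forall x, 0 <= g x) -> (forall x, 0 <= h x) ->
  (forall x, x != c -> g x = h x) ->
  (\int[mu]_x (g x)%:E = \int[mu]_x (h x)%:E)%E.
Proof.
move=> mg mh g0 h0 gh; apply: ge0_ae_eq_integral => //.
- exact/measurable_EFinP.
- exact/measurable_EFinP.
- by move=> x _; rewrite lee_fin.
- by move=> x _; rewrite lee_fin.
exists [set c]; split => //; first exact: lebesgue_measure_set1.
by move=> x/=; apply: contra_notP => xc _; rewrite gh//; exact/eqP.
Qed.

(** [y^b] as an integral over [[0, y]], in the form of a convolution. *)
Lemma powR_layer_cake b y : 0 < b -> 0 <= y ->
  (\int[mu]_x (powker 1 (y - x) * powker b x)%:E = (b^-1 * y `^ b)%:E)%E.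
Proof.
move=> b0 y0; have := @convol_powkerE R 1 b y ltr01 b0; rewrite /convol => ->.
congr EFin.
rewrite (@Gamma_nat R 0%N : Gamma (1 : R) = 1) mul1r addrC GammaS// invfM.
rewrite mulrCA mulfV ?mulr1; last by rewrite gt_eqF// Gamma_gt0.
congr (_ * _); rewrite /powker addrK; case: ltP => // yle0.
have -> : y = 0 by apply/eqP; rewrite eq_le yle0.
by rewrite powR0 ?gt_eqF.
Qed.

Let moment b t : \bar R := (\int[mu]_x ((powker b x)%:E * cdf t x))%E.

(** Layer-cake formula: up to the single point [x = Y t], the conditions [x < Y t] and
[D x <= t] agree. *)
Lemma moment_cdf b t : 0 < b -> 0 <= t ->
  (\int[P]_w (Y t w `^ b)%:E = b%:E * moment b t)%E.
Proof.
move=> b0 t0.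
have mb : measurable_fun setT (fun z : T * R => (powker b z.2 * below t z.2 z.1)%:E).
  apply/measurable_EFinP; apply: measurable_funM.
    by apply: (measurableT_comp (measurable_powker b)).
  have mp : measurable_fun setT (fun z : T * R => (z.2, z.1)) by exact: measurable_fun_pair.
  exact: (measurableT_comp (measurable_below_xw t) mp).
have f0 w x : (0 <= (powker b x * below t x w)%:E)%E.
  by rewrite lee_fin mulr_ge0// powker_ge0.
transitivity (\int[P]_w (b%:E * \int[mu]_x (powker b x * below t x w)%:E))%E.
  apply: ge0_ae_eq_integral => //.
  - apply/measurable_EFinP; apply: (measurableT_comp (measurable_powR b)).
    exact: measurable_inverse_process.
  - apply: measurable_funeM.
    exact: (@measurable_tonelli _ _ _ _ _ mu (fun w x => (powker b x * below t x w)%:E) mb f0).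
  - by move=> w _; rewrite lee_fin powR_ge0.
  - move=> w _; rewrite mule_ge0 ?lee_fin ?(ltW b0)//.
    by apply: integral_ge0 => x _; rewrite lee_fin mulr_ge0// powker_ge0.
  exists [set w | passage_times t w = set0]; split.
  - exact: measurable_passage_empty.
  - exact: passage_empty_null.
  move=> w /=; apply: contra_notP => /eqP/set0P ne _.
  have <- : (\int[mu]_x (powker 1 (Y t w - x) * powker b x)%:E =
      \int[mu]_x (powker b x * below t x w)%:E)%E.
    apply: (@ge0_eq_integral_but1 (Y t w)).
    - apply: measurable_funM; last exact: measurable_powker.
      by apply: (measurableT_comp (measurable_powker 1)); exact: measurable_funB.
    - apply: measurable_funM; first exact: measurable_powker.
      have mp : measurable_fun setT (fun x : R => (x, w)) by exact: measurable_fun_pair.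
      exact: (measurableT_comp (measurable_below_xw t) mp).
    - by move=> x; rewrite mulr_ge0 ?powker_ge0.
    - by move=> x; rewrite mulr_ge0 ?powker_ge0.
    move=> x xY; have [x0|x0] := leP x 0; first by rewrite (powker_le0 b x0) mul0r mulr0.
    rewrite mulrC; congr (_ * _); rewrite /powker /below subrr powRr0 subr_gt0.
    rewrite max_r ?(ltW x0)//.
    have [xltY|] := ltP x (Y t w); first by rewrite lt_inverse_process// ltW.
    rewrite le_eqVlt eq_sym (negbTE xY)/= => Yx; case: ifPn => // Dx.
    by have := inverse_process_ge ne (ltW x0) Dx; rewrite leNgt Yx.
  rewrite powR_layer_cake ?inverse_process_ge0// -EFinM.
  by rewrite mulrA divff ?mul1r// gt_eqF.
rewrite ge0_integralZl//; last 3 first.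
- exact: (@measurable_tonelli _ _ _ _ _ mu (fun w x => (powker b x * below t x w)%:E) mb f0).
- by move=> w _; exact: integral_ge0.
- by rewrite lee_fin ltW.
congr (_ * _)%E; rewrite /moment.
rewrite (@tonelli_swap _ _ _ _ _ P mu (fun w x => (powker b x * below t x w)%:E))//.
apply: eq_integral => x _; under eq_integral do rewrite EFinM.
rewrite ge0_integralZl//.
- apply/measurable_EFinP.
  have mp : measurable_fun setT (fun w : T => (x, w)) by exact: measurable_fun_pair.
  exact: (measurableT_comp (measurable_below_xw t) mp).
- by move=> w _; rewrite lee_fin.
- by rewrite lee_fin powker_ge0.
Qed.

Lemma moment_le b t : 0 < b -> (moment b t <= (expR t * Gamma b)%:E)%E.
Proof.
move=> b0; rewrite EFinM GammaE//.
rewrite /laplace -ge0_integralZl//; last 2 first.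
- by apply: measurable_laplace_integrand; exact: measurable_powker.
- by move=> x _; rewrite lee_fin mulr_ge0 ?expR_ge0// powker_ge0.
apply: ge0_le_integral => //.
- by move=> x _; rewrite mule_ge0// lee_fin powker_ge0.
- apply: emeasurable_funM; last exact: measurable_cdf_x.
  by apply/measurable_EFinP; exact: measurable_powker.
- by apply: measurable_funeM; apply: measurable_laplace_integrand; exact: measurable_powker.
move=> x _; have [x0|x0] := leP x 0.
  by rewrite powker_le0// mul0e mulr0 mule0.
have -> : ((expR t)%:E * (expR (- (1 * x)) * powker b x)%:E =
    (powker b x)%:E * (expR (t - x))%:E)%E.
  by rewrite -!EFinM expRD mul1r; congr EFin; ring.
apply: lee_wpmul2l; first by rewrite lee_fin powker_ge0.
apply: le_trans (prob_le_D t (ltW x0)).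
rewrite -[X in P X]setIT -integral_indic//; last exact: measurable_le_D (ltW x0).
rewrite le_eqVlt; apply/orP; left; apply/eqP; apply: eq_integral => w _.
rewrite /below max_r ?(ltW x0)// indicE; case: ifPn => Dt; first by rewrite mem_set.
by rewrite memNset//=; exact/negP.
Qed.

(** Tonelli, and the integral of [exp (- s t)] over [t >= D x]. *)
Lemma laplace_cdf s x : 0 < s -> 0 <= x ->
  (\int[mu]_t ((expR (- (s * t)))%:E * cdf t x) =
   (s^-1 * expR (- (x * s `^ alpha)))%:E)%E.
Proof.
move=> s0 x0.
have mE : measurable_fun setT (fun t : R => (expR (- (s * t)))%:E).
  by apply/measurable_EFinP; exact: measurable_expRN.
have mb : measurable_fun setT (fun z : R * T => (expR (- (s * z.1)) * below z.1 x z.2)%:E).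
  apply/measurable_EFinP; apply: measurable_funM => //.
  by apply: (measurableT_comp (measurable_expRN s)).
have f0 t w : (0 <= (expR (- (s * t)) * below t x w)%:E)%E.
  by rewrite lee_fin mulr_ge0// expR_ge0.
transitivity (\int[mu]_t \int[P]_w (expR (- (s * t)) * below t x w)%:E)%E.
  apply: eq_integral => t _; rewrite -ge0_integralZl//; last 2 first.
  - apply/measurable_EFinP.
    have mp : measurable_fun setT (fun w : T => (t, w)) by exact: measurable_fun_pair.
    exact: (measurableT_comp (measurable_below_tw x) mp).
  - by move=> w _; rewrite lee_fin.
rewrite (@tonelli_swap _ _ _ _ _ mu P (fun t w => (expR (- (s * t)) * below t x w)%:E))//.
transitivity (\int[P]_w ((s^-1)%:E * (expR (- (s * D x w)))%:E))%E.
  apply: eq_integral => w _.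
  have m1 : measurable_fun setT (fun t => powker 1 (t - D x w)).
    by apply: (measurableT_comp (measurable_powker 1)); exact: measurable_funB.
  transitivity (\int[mu]_t (expR (- (s * t)) * powker 1 (t - D x w))%:E)%E.
    apply: (@ge0_eq_integral_but1 (D x w)).
    - apply: measurable_funM; first exact: measurable_expRN.
      have mp : measurable_fun setT (fun t : R => (t, w)) by exact: measurable_fun_pair.
      exact: (measurableT_comp (measurable_below_tw x) mp).
    - apply: measurable_funM => //; exact: measurable_expRN.
    - by move=> t; rewrite mulr_ge0// expR_ge0.
    - by move=> t; rewrite mulr_ge0 ?expR_ge0 ?powker_ge0.
    move=> t tD; congr (_ * _); rewrite /below max_r// /powker subrr powRr0 subr_gt0.
    by rewrite le_eqVlt eq_sym (negbTE tD).
  rewrite (@ge0_integral_affine _ 1 (D x w))//; last 2 first.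
  - by apply/measurable_EFinP; apply: measurable_funM => //; exact: measurable_expRN.
  - by move=> t; rewrite lee_fin mulr_ge0 ?expR_ge0 ?powker_ge0.
  rewrite mul1e; under eq_integral.
    move=> t _; rewrite mul1r addrK mulrDr opprD expRD (mulrC (expR _)) -mulrA EFinM; over.
  rewrite ge0_integralZl//; last 2 first.
  - by apply: measurable_laplace_integrand; exact: measurable_powker.
  - by move=> t _; rewrite lee_fin mulr_ge0 ?expR_ge0// powker_ge0.
  rewrite -/(laplace _ _) laplace_powkerE// (@Gamma_nat R 0%N : Gamma (1 : R) = 1) mul1r.
  by rewrite powR_inv1 ?(ltW s0)// muleC.
rewrite ge0_integralZl//; last 2 first.
- apply/measurable_EFinP; apply: (measurableT_comp (measurable_expRN s)); exact: mD.
- by rewrite lee_fin invr_ge0 ltW.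
by rewrite D_laplace ?(ltW s0)// -EFinM.
Qed.

Lemma laplace_moment b s : 0 < b -> 0 < s ->
  (\int[mu]_t ((expR (- (s * t)))%:E * moment b t) =
   (Gamma b * s `^ (- (alpha * b + 1)))%:E)%E.
Proof.
move=> b0 s0.
have mE : measurable_fun setT (fun t : R => (expR (- (s * t)))%:E).
  by apply/measurable_EFinP; exact: measurable_expRN.
have mP : measurable_fun setT (fun x : R => (powker b x)%:E).
  by apply/measurable_EFinP; exact: measurable_powker.
have mb : measurable_fun setT (fun z : R * R =>
    (expR (- (s * z.1)))%:E * ((powker b z.2)%:E * cdf z.1 z.2))%E.
  apply: emeasurable_funM; first exact: (measurableT_comp mE).
  by apply: emeasurable_funM => //; exact: (measurableT_comp mP).
have P0 x : (0 <= (powker b x)%:E)%E by rewrite lee_fin powker_ge0.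
have f0 t x : (0 <= (expR (- (s * t)))%:E * ((powker b x)%:E * cdf t x))%E.
  by rewrite !mule_ge0// lee_fin expR_ge0.
transitivity (\int[mu]_t \int[mu]_x
    ((expR (- (s * t)))%:E * ((powker b x)%:E * cdf t x)))%E.
  apply: eq_integral => t _; rewrite -ge0_integralZl//.
  - by apply: emeasurable_funM => //; exact: measurable_cdf_x.
  - by move=> x _; rewrite mule_ge0.
rewrite (@tonelli_swap _ _ _ _ _ mu mu (fun t x =>
   (expR (- (s * t)))%:E * ((powker b x)%:E * cdf t x))%E)//.
transitivity (\int[mu]_x ((s^-1)%:E * (expR (- (s `^ alpha * x)) * powker b x)%:E))%E.
  apply: eq_integral => x _; have [x0|x0] := leP x 0.
    rewrite powker_le0// mulr0 mule0; apply: integral0_eq => t _.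
    by rewrite mul0e mule0.
  under eq_integral do rewrite muleCA.
  rewrite ge0_integralZl//; last 2 first.
  - by apply: emeasurable_funM => //; exact: measurable_cdf_t.
  - by move=> t _; rewrite mule_ge0// lee_fin expR_ge0.
  by rewrite laplace_cdf ?(ltW x0)// -!EFinM; congr EFin; rewrite [x * _]mulrC; ring.
have sa : 0 < s `^ alpha by rewrite powR_gt0.
rewrite ge0_integralZl//; last 3 first.
- by apply: measurable_laplace_integrand; exact: measurable_powker.
- by move=> t _; rewrite lee_fin mulr_ge0 ?expR_ge0// powker_ge0.
- by rewrite lee_fin invr_ge0 ltW.
rewrite -/(laplace _ _) laplace_powkerE// -EFinM; congr EFin.
rewrite -powRrM mulrN opprD powRDp// powR_inv1 ?(ltW s0)//; ring.
Qed.

Let moment_ge0 b t : (0 <= moment b t)%E.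
Proof. by apply: integral_ge0 => x _; rewrite mule_ge0// lee_fin powker_ge0. Qed.

Let moment_fin b t : 0 < b -> moment b t \is a fin_num.
Proof.
move=> b0; rewrite ge0_fin_numE//; apply: le_lt_trans (moment_le t b0) _.
by rewrite ltry.
Qed.

Let measurable_moment b : measurable_fun setT (moment b).
Proof.
apply: (@measurable_tonelli _ _ _ _ R mu (fun t x => (powker b x)%:E * cdf t x)%E).
  apply: emeasurable_funM => //.
  have mP : measurable_fun setT (fun x : R => (powker b x)%:E).
    by apply/measurable_EFinP; exact: measurable_powker.
  exact: (measurableT_comp mP).
by move=> t x; rewrite mule_ge0// lee_fin powker_ge0.
Qed.

Let moment_homo b t u : t <= u -> (moment b t <= moment b u)%E.
Proof.
move=> tu; have mP : measurable_fun setT (fun x : R => (powker b x)%:E).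
  by apply/measurable_EFinP; exact: measurable_powker.
apply: ge0_le_integral => //.
- by move=> x _; rewrite mule_ge0// lee_fin powker_ge0.
- by apply: emeasurable_funM => //; exact: measurable_cdf_x.
- by apply: emeasurable_funM => //; exact: measurable_cdf_x.
move=> x _; apply: lee_wpmul2l; first by rewrite lee_fin powker_ge0.
have mw v : measurable_fun setT (fun w => (below v x w)%:E).
  apply/measurable_EFinP.
  have mp : measurable_fun setT (fun w : T => (x, w)) by exact: measurable_fun_pair.
  exact: (measurableT_comp (measurable_below_xw v) mp).
apply: ge0_le_integral => // w _; rewrite lee_fin//.
rewrite /below; case: ifPn => Dt; last by case: ifP.
by rewrite (le_trans Dt).
Qed.

Let moment_lt0 b t : t < 0 -> moment b t = 0%E.
Proof.
move=> t0; apply: integral0_eq => x _; rewrite /cdf integral0_eq ?mule0// => w _.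
rewrite /below ifF//; apply/negbTE; rewrite -ltNge (lt_le_trans t0)// D_ge0//.
by rewrite le_max lexx.
Qed.

(** Both sides have the Laplace transform computed in [laplace_moment]; the left one
is nondecreasing, the right one is also continuous. *)
Lemma momentE b t : 0 < b -> 0 < t ->
  moment b t = (Gamma b / Gamma (alpha * b + 1) * t `^ (alpha * b))%:E.
Proof.
move=> b0 t0.
pose g u := if 0 < u then fine (moment b u) else 0.
pose c := Gamma b / Gamma (alpha * b + 1).
have ab0 : 0 < alpha * b by rewrite mulr_gt0.
have ab1 : 0 < alpha * b + 1 by rewrite addr_gt0.
have c0 : 0 <= c by rewrite divr_ge0// ltW// Gamma_gt0.
pose h u := c * powker (alpha * b + 1) u.
have pg : positive_part_only g.
  split.
  - apply: measurable_fun_ifT => //; first exact: measurable_fun_ltr.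
    by apply: measurableT_comp => //; exact: measurable_moment.
  - by move=> x; rewrite /g; case: ifP => // _; rewrite fine_ge0.
  - by move=> x x0; rewrite /g ltNge x0.
have ph : positive_part_only h.
  split.
  - by apply: measurable_funM => //; exact: measurable_powker.
  - by move=> x; rewrite mulr_ge0// powker_ge0.
  - by move=> x x0; rewrite /h powker_le0// mulr0.
have lg s : 0 < s -> laplace g s = (Gamma b * s `^ (- (alpha * b + 1)))%:E.
  move=> s0; rewrite -laplace_moment//; apply: ge0_ae_eq_integral => //.
  - by apply: measurable_laplace_integrand; case: pg.
  - apply: emeasurable_funM; last exact: measurable_moment.
    by apply/measurable_EFinP; exact: measurable_expRN.
  - by move=> x _; rewrite lee_fin mulr_ge0 ?expR_ge0//; case: pg.
  - by move=> x _; rewrite mule_ge0// lee_fin expR_ge0.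
  exists [set 0]; split => //; first exact: lebesgue_measure_set1.
  move=> u/=; apply: contra_notP => /eqP u0 _.
  rewrite EFinM /g; case: ltgtP u0 => // u0 _; last by rewrite moment_lt0.
  by rewrite fineK// moment_fin.
have lh s : 0 < s -> laplace h s = (Gamma b * s `^ (- (alpha * b + 1)))%:E.
  move=> s0; rewrite /laplace.
  under eq_integral do rewrite mulrCA EFinM.
  rewrite ge0_integralZl//; last 2 first.
  - by apply: measurable_laplace_integrand; exact: measurable_powker.
  - by move=> x _; rewrite lee_fin mulr_ge0 ?expR_ge0// powker_ge0.
  rewrite -/(laplace _ _) laplace_powkerE// -EFinM; congr EFin.
  by rewrite mulrA /c mulfVK// gt_eqF// Gamma_gt0.
have -> : moment b t = (g t)%:E by rewrite /g t0 fineK// moment_fin.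
have -> : g t = h t; last by rewrite /h powkerE// addrK.
apply: laplace_inj => //.
- by move=> s s0; rewrite lg// lh//; split => //; rewrite ltry.
- move=> x y; rewrite !in_itv/= !andbT => x0 y0 xy.
  rewrite /g x0 y0 fine_le ?moment_fin//; exact: moment_homo.
- move=> x y; rewrite !in_itv/= !andbT => x0 y0 xy.
  rewrite /h ler_wpM2l// !powkerE// addrK ge0_ler_powR ?nnegrE// ltW//.
- apply: differentiable_continuous; apply/derivable1_diffP.
  apply: (@near_eq_derivable _ _ _ (fun u => c * u `^ (alpha * b))) => //.
    near=> u; rewrite /h powkerE ?addrK//; near: u; exact: lt_nbhsr.
  by apply: derivableM => //; apply: derivable_powR; rewrite in_itv/= t0.
Unshelve. all: by end_near. Qed.

(** The value at [t = 0] follows from those at [t > 0] by monotonicity. *)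
Lemma inverse_process_moment b t : 0 < b -> 0 <= t ->
  (\int[P]_w (Y t w `^ b)%:E =
   (Gamma (b + 1) / Gamma (alpha * b + 1) * t `^ (alpha * b))%:E)%E.
Proof.
move=> b0 t0; rewrite moment_cdf//.
have ab0 : 0 < alpha * b by rewrite mulr_gt0.
have ab1 : 0 < alpha * b + 1 by rewrite addr_gt0.
move: t0; rewrite le_eqVlt => /predU1P[<-|t0]; last first.
  by rewrite momentE// GammaS// -EFinM !mulrA.
rewrite powR0 ?gt_eqF// mulr0.
suff -> : moment b 0 = 0%E by rewrite mule0.
apply/eqP; rewrite eq_le moment_ge0 andbT.
have := moment_fin 0 b0; have := @moment_homo b 0.
case: (moment b 0) => [r| |]// mono _; rewrite lee_fin leNgt; apply/negP => r0.
pose c := Gamma b / Gamma (alpha * b + 1).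
have c0 : 0 < c by rewrite divr_gt0// Gamma_gt0.
(* The time at which the moment equals r / 2. *)
pose u := (r / (2 * c)) `^ (alpha * b)^-1.
have rc0 : 0 < r / (2 * c) by rewrite divr_gt0// mulr_gt0.
have u0 : 0 < u by rewrite powR_gt0.
have := mono u (ltW u0); rewrite momentE// lee_fin -/c /u -powRrM.
rewrite mulVf ?gt_eqF// powRr1 ?(ltW rc0)//.
rewrite (_ : c * (r / (2 * c)) = r / 2); last by field; rewrite gt_eqF.
lra.
Qed.

End inverse_process.

(** * Mittag-Leffler series and their Caputo derivatives *)
Section series_integral.
Context d (T : measurableType d) (R : realType) (mu : {measure set T -> \bar R}).
Variables (D : set T) (f : nat -> T -> R) (F : T -> R).
Hypothesis mD : measurable D.
Hypothesis mf : forall n, measurable_fun D (f n).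
Hypothesis summable_f : (\sum_(n <oo) \int[mu]_(x in D) `|f n x|%:E < +oo)%E.
Hypothesis fF : forall x, D x -> series (f ^~ x) @ \oo --> F x.

Let G x : \bar R := (\sum_(n <oo) `|f n x|%:E)%E.

Lemma integral_series_abs : mu.-integrable D (EFin \o F) /\
  series (fun n => \int[mu]_(x in D) f n x) @ \oo --> \int[mu]_(x in D) F x.
Proof.
have mnf n : measurable_fun D (fun x => `|f n x|%:E).
  by apply/measurable_EFinP; apply: measurableT_comp.
have mG : measurable_fun D G by apply: ge0_emeasurable_sum.
have G0 x : (0 <= G x)%E by apply: nneseries_ge0.
have iG : mu.-integrable D G.
  apply/integrableP; split => //.
  rewrite (eq_integral G) => [|x _]; last by rewrite gee0_abs.
  by rewrite integral_nneseries.
have ifn n : mu.-integrable D (EFin \o f n).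
  apply: le_integrable iG => //; first exact/measurable_EFinP.
  move=> x Dx /=; rewrite (gee0_abs (G0 x)) /G.
  apply: (le_trans _ (@nneseries_lim_ge _ (fun n => `|f n x|%:E) xpredT 0 n.+1 _)) => //.
  by rewrite big_nat_recr//= leeDr// sume_ge0.
pose S N x := (series (f ^~ x) N)%:E.
have mS N : measurable_fun D (S N).
  apply/measurable_EFinP; rewrite /series/=.
  apply: (eq_measurable_fun (fun x => \sum_(i <- index_iota 0 N) f i x)) => //.
  exact: measurable_sum.
have mF : measurable_fun D F.
  apply: (@measurable_fun_cvg _ _ _ _ (fun N x => series (f ^~ x) N)) => //.
  by move=> N; apply/measurable_EFinP; exact: mS.
have [iF _ cF] : [/\ mu.-integrable D (EFin \o F),
    (\int[mu]_(x in D) `|S N x - (F x)%:E| @[N --> \oo] --> 0)%E &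
    (\int[mu]_(x in D) S N x @[N --> \oo] --> \int[mu]_(x in D) (F x)%:E)%E].
  apply: (@dominated_convergence _ _ _ mu D mD S (EFin \o F) G) => //.
  - exact/measurable_EFinP.
  - apply: aeW => x Dx; apply: cvg_EFin; first exact: nearW.
    exact: fF.
  - apply: aeW => x N _; rewrite /S/=.
    apply: (le_trans _ (@nneseries_lim_ge _ (fun n => `|f n x|%:E) xpredT 0 N _)) => //.
    by rewrite sumEFin lee_fin; exact: ler_norm_sum.
split => //.
have -> : series (fun n => \int[mu]_(x in D) f n x) =
    fine \o (fun N => \int[mu]_(x in D) S N x)%E.
  apply/funext => N; rewrite /S /series/=.
  under [in RHS]eq_integral do rewrite -sumEFin.
  rewrite integral_sum// -sum_fine// => n _.
  by apply: integrable_fin_num => //; exact: ifn.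
apply: fine_cvg; rewrite fineK//.
exact: (integrable_fin_num mD iF).
Qed.

End series_integral.

Section entire.
Context {R : realType}.
Implicit Types (a : nat -> R) (z : R).

(** Infinite radius of convergence, stated as boundedness of the terms. *)
Definition entire a := forall z, 0 <= z -> exists M, forall j, `|a j| * z ^+ j <= M.

Lemma entire_cvg_abs a z : entire a -> 0 <= z ->
  cvgn (series (fun j => `|a j| * z ^+ j)).
Proof.
move=> ea z0; have [M aM] := ea (2 * z) (mulr_ge0 (ler0n _ _) z0).
apply: (@series_le_cvg _ _ (geometric M 2^-1)).
- by move=> j; rewrite mulr_ge0// exprn_ge0.
- move=> j; rewrite /geometric/= mulr_ge0//.
  by apply: le_trans (aM 0%N); rewrite mulr_ge0.
- move=> j; rewrite /geometric/= exprVn ler_pdivlMr ?exprn_gt0//.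
  by rewrite -mulrA -exprMn mulrC [z * 2]mulrC mulrC.
- by apply: is_cvg_geometric_series; rewrite ger0_norm// invf_lt1// ltr1n.
Qed.

Lemma entire_cvg a z : entire a -> cvgn (pseries a z).
Proof.
move=> ea; apply: normed_cvg; have := entire_cvg_abs ea (normr_ge0 z).
rewrite /normed_series_of /= [X in _ -> cvgn (series X)](_ : _ = (fun j => `|a j| * `|z| ^+ j))//.
by apply/funext => j; rewrite normrM normrX.
Qed.

Lemma entire_diffs a : entire a -> entire (pseries_diffs a).
Proof.
move=> ea z z0.
have z20 : 0 <= 2 * (z + 1) by rewrite mulr_ge0// addr_ge0.
have [M aM] := ea _ z20; exists M => j; apply: le_trans (aM j.+1).
rewrite /pseries_diffs normrM mulrAC mulrC ler_wpM2l//.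
rewrite ger0_norm// exprMn; apply: ler_pM => //; first by rewrite exprn_ge0.
  by rewrite -natrX ler_nat ltnW// ltn_expl.
apply: (@le_trans _ _ ((z + 1) ^+ j)).
  by rewrite lerXn2r ?nnegrE ?addr_ge0// lerDl.
by rewrite exprS ler_peMl ?exprn_ge0 ?addr_ge0// lerDr.
Qed.

Lemma is_derive_entire a z : entire a ->
  is_derive z (1 : R) (fun x => limn (pseries a x)) (limn (pseries (pseries_diffs a) z)).
Proof.
move=> ea; apply: (@pseries_snd_diffs _ _ (`|z| + 1)).
- exact: entire_cvg.
- by apply: entire_cvg; exact: entire_diffs.
- by apply: entire_cvg; do 2 apply: entire_diffs.
- by rewrite [ltRHS]ger0_norm ?ltrDl// addr_ge0.
Qed.

End entire.

Section mittag_leffler.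
Context {R : realType}.
Local Notation mu := (@lebesgue_measure R).
Variables (alpha : R).
Hypothesis alpha0 : 0 < alpha.
Implicit Types (b : nat -> R) (t : R).

(** The growth condition under which the Mittag-Leffler series of [b] has an infinite
radius of convergence; stable under the shift of [b]. *)
Definition geom_bounded b := exists C K, [/\ 0 <= C, 0 <= K & forall j, `|b j| <= C * K ^+ j].

Definition ml_coef b j : R := b j / Gamma (alpha * j%:R + 1).

Definition mittag_leffler b t : R := limn (pseries (ml_coef b) (t `^ alpha)).

Lemma Gamma_alpha_gt0 j : 0 < Gamma (alpha * j%:R + 1) :> R.
Proof. by rewrite Gamma_gt0// ltr_wpDl// mulr_ge0// ltW. Qed.

Lemma geom_bounded_shift b : geom_bounded b -> geom_bounded (fun j => b j.+1).
Proof.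
move=> [C [K [C0 K0 bCK]]]; exists (C * K), K; split => //; first exact: mulr_ge0.
by move=> j; rewrite -mulrA -exprS.
Qed.

(** [Gamma_lower] at a point [c] with [c^alpha = K z + 1] absorbs [(K z)^j]. *)
Lemma entire_ml_coef b : geom_bounded b -> entire (ml_coef b).
Proof.
move=> [C [K [C0 K0 bCK]]] z z0.
have Kz0 : 0 <= K * z by rewrite mulr_ge0.
pose A := (K * z + 1) `^ alpha^-1.
have Kz1 : 0 < K * z + 1 by rewrite ltr_wpDl.
have A0 : 0 <= A by exact: powR_ge0.
have AE j : A `^ (alpha * j%:R) = (K * z + 1) ^+ j.
  rewrite powRrM -[A `^ alpha]powRrM mulVf ?gt_eqF// powRr1 ?(ltW Kz1)//.
  by rewrite powR_mulrn// ltW.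
exists (C * expR A) => j; rewrite /ml_coef normrM normfV (gtr0_norm (Gamma_alpha_gt0 j)).
rewrite mulrAC ler_pdivrMr ?Gamma_alpha_gt0//.
have GA := Gamma_lower (mulr_ge0 (ltW alpha0) (ler0n R j)) A0.
apply: (@le_trans _ _ (C * expR A * (A `^ (alpha * j%:R) * expR (- A)))); last first.
  by rewrite ler_wpM2l// mulr_ge0// expR_ge0.
rewrite (_ : C * _ * _ = C * A `^ (alpha * j%:R) * (expR A * expR (- A))); last by ring.
rewrite expRxMexpNx_1 mulr1 AE.
apply: (@le_trans _ _ (C * K ^+ j * z ^+ j)).
  by rewrite ler_wpM2r// exprn_ge0.
by rewrite -mulrA -exprMn ler_wpM2l// lerXn2r ?nnegrE ?(ltW Kz1)// lerDl.
Qed.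

Lemma is_derive_mittag_leffler b t : geom_bounded b -> 0 < t ->
  is_derive t (1 : R) (mittag_leffler b)
    (limn (pseries (pseries_diffs (ml_coef b)) (t `^ alpha)) * (alpha * t `^ (alpha - 1))).
Proof.
move=> gb t0; have ea := entire_ml_coef gb.
have d1 := is_derive1_powR alpha t0.
have d2 := is_derive_entire (t `^ alpha) ea.
rewrite (_ : mittag_leffler b = (fun x : R => limn (pseries (ml_coef b) x)) \o (fun x : R => x `^ alpha))//.
exact: is_derive1_comp.
Qed.

Lemma continuous_mittag_leffler b t : geom_bounded b -> 0 < t ->
  {within `[0, t], continuous (mittag_leffler b)}.
Proof.
move=> gb t0; apply/continuous_within_itvP => //; split.
- move=> x; rewrite in_itv/= => /andP[x0 _].
  have d := is_derive_mittag_leffler gb x0.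
  by apply: differentiable_continuous; apply/derivable1_diffP; exact: ex_derive.
- rewrite /mittag_leffler powR0 ?gt_eqF//.
  have c : {for 0, continuous (fun x : R => limn (pseries (ml_coef b) x))}.
    have d := is_derive_entire 0 (entire_ml_coef gb).
    by apply: differentiable_continuous; apply/derivable1_diffP; exact: ex_derive.
  exact: (cvg_comp _ _ (powR_cvg0 alpha0) c).
- have d := is_derive_mittag_leffler gb t0.
  apply: cvg_at_left_filter; apply: differentiable_continuous.
  by apply/derivable1_diffP; exact: ex_derive.
Qed.

Let dterm b j t : R :=
  b j.+1 / Gamma (alpha * j.+1%:R) * powker (alpha * j.+1%:R) t.

Lemma derive_mittag_leffler b t : geom_bounded b -> 0 < t ->
  series (dterm b ^~ t) @ \oo --> derive1 (mittag_leffler b) t.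
Proof.
move=> gb t0; have d := is_derive_mittag_leffler gb t0.
rewrite derive1E derive_val.
have -> : series (dterm b ^~ t) =
    (fun n => pseries (pseries_diffs (ml_coef b)) (t `^ alpha) n * (alpha * t `^ (alpha - 1))).
  apply/funext => n; rewrite /pseries /series/= big_distrl/=; apply: eq_bigr => j _.
  have aj0 : 0 < alpha * j.+1%:R by rewrite mulr_gt0.
  rewrite /dterm /pseries_diffs /ml_coef GammaS// powkerE//.
  rewrite -powR_mulrn ?powR_ge0// -powRrM.
  rewrite (_ : alpha * j.+1%:R - 1 = alpha * j%:R + (alpha - 1)); last first.
    by rewrite -natr1; ring.
  rewrite (powRDp (alpha * j%:R) (alpha - 1) t0); move: (Gamma _) (Gamma_gt0 aj0) => G G0.
  have : j.+1%:R != 0 :> R by rewrite pnatr_eq0.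
  by move: j.+1%:R => n1 n10; field; rewrite n10 !gt_eqF.
apply: cvgMl; apply: entire_cvg; apply: entire_diffs; exact: entire_ml_coef.
Qed.

Lemma nneseries_EFin (v : nat -> R) : cvgn (series v) ->
  (\sum_(n <oo) (v n)%:E = (limn (series v))%:E)%E.
Proof.
move=> cv; rewrite -EFin_lim//; congr (limn _); apply/funext => n.
by rewrite /= sumEFin.
Qed.

Hypothesis alpha1 : alpha < 1.

Lemma integral_itv_convol (g h : R -> R) t :
  (forall x, x <= 0 -> g x = 0) -> (forall x, x <= 0 -> h x = 0) ->
  (\int[mu]_(s in `]0%R, t[) (g (t - s) * h s)%:E = convol g h t)%E.
Proof.
move=> g0 h0; rewrite integral_mkcond; apply: eq_integral => s _.
rewrite patchE mem_setE/= in_itv/=; have [s0|s0] := leP s 0.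
  by rewrite (h0 _ s0) mulr0.
by have [//|st] := ltP s t; rewrite g0 ?mul0r// subr_le0.
Qed.

(** The derivative of [t^(alpha j) / Gamma(alpha j + 1)] is a power kernel divided
by Gamma, and its convolution with [s^(- alpha)] is a Beta integral; the factor
[Gamma(1 - alpha)] cancels and the exponent of the result is [alpha (j - 1)].  The
series of absolute integrals converges, so the sum is integrated term by term. *)
Lemma caputo_mittag_leffler b (u : R -> R) t : geom_bounded b -> 0 < t ->
  (forall s, 0 <= s -> u s = mittag_leffler b s) ->
  caputo_defined alpha u t /\
  caputo alpha u t = mittag_leffler (fun j => b j.+1) t.
Proof.
move=> gb t0 ub.
have gbS := geom_bounded_shift gb.
have du (s : R) : 0 < s -> is_derive s (1 : R) u (derive1 (mittag_leffler b) s).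
  move=> s0; have d := is_derive_mittag_leffler gb s0.
  rewrite derive1E derive_val; apply: near_eq_is_derive d => //.
  near=> x; rewrite ub//; near: x; have := lt_nbhsr s0; apply: filterS => x.
  exact: ltW.
have a10 : 0 < 1 - alpha by rewrite subr_gt0.
have aj0 j : 0 < alpha * j.+1%:R by rewrite mulr_gt0.
pose c j := `|b j.+1 / Gamma (alpha * j.+1%:R)|.
pose f j s := powker (1 - alpha) (t - s) * dterm b j s.
have mf j : measurable_fun setT (f j).
  apply: measurable_funM; last by apply: measurable_funM => //; exact: measurable_powker.
  apply: (measurableT_comp (measurable_powker _)); exact: measurable_funB.
have ka j : Gamma (1 - alpha) * Gamma (alpha * j.+1%:R) / Gamma (1 - alpha + alpha * j.+1%:R) *
    powker (1 - alpha + alpha * j.+1%:R) t =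
  Gamma (1 - alpha) * Gamma (alpha * j.+1%:R) / Gamma (alpha * j%:R + 1) * (t `^ alpha) ^+ j.
  rewrite (_ : 1 - alpha + alpha * j.+1%:R = alpha * j%:R + 1); last by rewrite -natr1; ring.
  by rewrite powkerE// addrK -powR_mulrn ?powR_ge0// -powRrM.
have alg (x g1 g2 g3 z : R) : 0 < g2 -> x / g2 * (g1 * g2 / g3 * z) = g1 * (x / g3 * z).
  by move=> g20; rewrite [g1 * g2]mulrC -!mulrA mulKf ?gt_eqF//; ring.
have intf j : (\int[mu]_(s in `]0%R, t[) `|f j s|%:E =
    (Gamma (1 - alpha) * (`|ml_coef (fun j => b j.+1) j| * (t `^ alpha) ^+ j))%:E)%E.
  transitivity (\int[mu]_(s in `]0%R, t[)
      ((c j)%:E * (powker (1 - alpha) (t - s) * powker (alpha * j.+1%:R) s)%:E))%E.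
    apply: eq_integral => s _; rewrite /f /dterm -EFinM; congr EFin.
    rewrite !normrM (ger0_norm (powker_ge0 _ _)) (ger0_norm (powker_ge0 _ _)).
    by rewrite /c normrM mulrCA.
  rewrite ge0_integralZl//; last 3 first.
  - apply/measurable_EFinP; apply: (@measurable_funS _ _ _ _ setT) => //.
    apply: measurable_funM; last exact: measurable_powker.
    by apply: (measurableT_comp (measurable_powker _)); exact: measurable_funB.
  - by move=> s _; rewrite lee_fin mulr_ge0// powker_ge0.
  - by rewrite lee_fin /c normr_ge0.
  rewrite integral_itv_convol; [|exact: powker_le0|exact: powker_le0].
  rewrite convol_powkerE// ka -EFinM; congr EFin.
  rewrite /c /ml_coef !normf_div (gtr0_norm (Gamma_gt0 (aj0 j))).
  by rewrite (gtr0_norm (Gamma_alpha_gt0 j)) alg// Gamma_gt0.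
have intfR j : \int[mu]_(s in `]0, t[) f j s =
    Gamma (1 - alpha) * (ml_coef (fun j => b j.+1) j * (t `^ alpha) ^+ j).
  transitivity (\int[mu]_(s in `]0, t[)
      (b j.+1 / Gamma (alpha * j.+1%:R) *
       (powker (1 - alpha) (t - s) * powker (alpha * j.+1%:R) s))).
    by apply: eq_Rintegral => s _; rewrite /f /dterm mulrCA.
  have mk : measurable_fun `]0, t[ (EFin \o (fun s => powker (1 - alpha) (t - s) * powker (alpha * j.+1%:R) s)).
    apply/measurable_EFinP; apply: (@measurable_funS _ _ _ _ setT) => //.
    apply: measurable_funM; last exact: measurable_powker.
    by apply: (measurableT_comp (measurable_powker _)); exact: measurable_funB.
  rewrite RintegralZl//; last first.
    apply/integrableP; split => //.
    under eq_integral => s _ do rewrite /= ger0_norm ?mulr_ge0 ?powker_ge0//.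
    rewrite integral_itv_convol; [|exact: powker_le0|exact: powker_le0].
    by rewrite convol_powkerE// ltry.
  rewrite /Rintegral integral_itv_convol; [|exact: powker_le0|exact: powker_le0].
  by rewrite convol_powkerE//= ka /ml_coef alg// Gamma_gt0.
have sumf : (\sum_(j <oo) \int[mu]_(s in `]0%R, t[) `|f j s|%:E < +oo)%E.
  rewrite (eq_eseriesr (fun j _ => intf j)) nneseries_EFin ?ltry//.
  rewrite [X in cvgn X](_ : _ = (fun n => Gamma (1 - alpha) *
     series (fun j => `|ml_coef (fun j => b j.+1) j| * (t `^ alpha) ^+ j) n)); last first.
    by apply/funext => n; rewrite /series/= big_distrr.
  apply: is_cvgMr; apply: entire_cvg_abs; first exact: entire_ml_coef.
  exact: powR_ge0.
have fF s : `]0, t[%classic s -> series (f ^~ s) @ \oo --> caputo_integrand alpha u t s.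
  rewrite /= in_itv/= => /andP[s0 st].
  rewrite /caputo_integrand (_ : series (f ^~ s) =
      (fun n => (t - s) `^ (- alpha) * series (dterm b ^~ s) n)).
    apply: cvgMr; have ds := du s s0; rewrite derive1E derive_val.
    exact: derive_mittag_leffler.
  apply/funext => n; rewrite /series/= big_distrr/=; apply: eq_bigr => j _.
  by rewrite /f powkerE ?subr_gt0//; congr (_ `^ _ * _); ring.
have mf' j : measurable_fun `]0, t[ (f j) by exact: (@measurable_funS _ _ _ _ setT).
have [iF cF] := @integral_series_abs _ _ R mu `]0, t[%classic f
  (caputo_integrand alpha u t) (measurable_itv _) mf' sumf fF.
split.
  split => //; last by move=> s s0 _; have d := du s s0; exact: ex_derive.
  have := continuous_mittag_leffler gb t0.
  apply: (@subspace_eq_continuous _ _ _ (mittag_leffler b) u) => x.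
  by rewrite inE/= in_itv/= => /andP[x0 _]; exact/esym/ub.
rewrite /caputo.
suff -> : \int[mu]_(s in `]0, t[) caputo_integrand alpha u t s =
   Gamma (1 - alpha) * mittag_leffler (fun j => b j.+1) t.
  by rewrite mulKf// gt_eqF// Gamma_gt0.
rewrite -(cvg_lim _ cF)//; apply/cvg_lim => //.
rewrite [X in X @ _](_ : _ = (fun n => Gamma (1 - alpha) *
     pseries (ml_coef (fun j => b j.+1)) (t `^ alpha) n)).
  by apply: cvgMr; apply: entire_cvg; exact: entire_ml_coef.
apply/funext => n; rewrite /pseries /series/= big_distrr/=.
by apply: eq_bigr => j _; exact: intfR.
Unshelve. all: by end_near. Qed.

End mittag_leffler.

(** * Power series of the inverse stable subordinator *)
Section expectation_series.
Context d (T : measurableType d) {R : realType} (P : probability T R).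
Variables (alpha : R) (D : R -> T -> R).
Hypothesis alpha0 : 0 < alpha.
Hypothesis subD : subordinator P (fun s => s `^ alpha) D.

Lemma inverse_process_moment_nat (j : nat) (t : R) : 0 <= t ->
  (\int[P]_w (inverse_process D t w ^+ j)%:E =
   (j`!%:R / Gamma (alpha * j%:R + 1) * (t `^ alpha) ^+ j)%:E)%E.
Proof.
move=> t0; case: j => [|j].
  under eq_integral do rewrite expr0.
  have := expectation_cst P 1; rewrite unlock => ->; rewrite mulr0 add0r.
  by rewrite (@Gamma_nat R 0%N : Gamma (1 : R) = 1) divr1 mulr1.
have j0 : 0 < j.+1%:R :> R by [].
have := inverse_process_moment alpha0 subD j0 t0.
rewrite natr1 Gamma_nat powRrM powR_mulrn ?powR_ge0// => <-.
by apply: eq_integral => w _; rewrite powR_mulrn// inverse_process_ge0.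
Qed.

(** The factor [j!] of the [j]-th moment turns an exponential series in [y] into a
Mittag-Leffler series in [t]. *)
Lemma expectation_inverse_process (b : nat -> R) (q : R -> R) (t : R) :
  geom_bounded b -> 0 <= t ->
  (forall y, 0 <= y -> series (fun j => b j / j`!%:R * y ^+ j) @ \oo --> q y) ->
  \int[P]_w q (inverse_process D t w) = mittag_leffler alpha b t.
Proof.
move=> gb t0 hq.
pose Y := inverse_process D t.
have mY : measurable_fun setT Y by exact: (measurable_inverse_process subD).
have Y0 w : 0 <= Y w by exact: inverse_process_ge0.
pose f j w := b j / j`!%:R * Y w ^+ j.
have mf j : measurable_fun setT (f j).
  by apply: measurable_funM => //; exact: measurable_funX.
have mYj j : measurable_fun setT (fun w => (Y w ^+ j)%:E).
  by apply/measurable_EFinP; exact: measurable_funX.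
have jE j (x : R) : x / j`!%:R * (j`!%:R / Gamma (alpha * j%:R + 1) * (t `^ alpha) ^+ j) =
    x / Gamma (alpha * j%:R + 1) * (t `^ alpha) ^+ j.
  have j0 : j`!%:R != 0 :> R by rewrite pnatr_eq0 -lt0n fact_gt0.
  by rewrite -!mulrA mulKf.
have iabs j : (\int[P]_w `|f j w|%:E = (`|ml_coef alpha b j| * (t `^ alpha) ^+ j)%:E)%E.
  transitivity (\int[P]_w ((`|b j| / j`!%:R)%:E * (Y w ^+ j)%:E))%E.
    apply: eq_integral => w _; rewrite /f normrM normf_div (ger0_norm (ler0n _ _)).
    by rewrite (ger0_norm (exprn_ge0 _ (Y0 w))) EFinM.
  rewrite ge0_integralZl//; last first.
    by move=> w _; rewrite lee_fin exprn_ge0.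
  rewrite inverse_process_moment_nat// -EFinM jE; congr EFin.
  by rewrite /ml_coef normf_div (gtr0_norm (Gamma_alpha_gt0 alpha0 j)).
have iR j : \int[P]_w f j w = ml_coef alpha b j * (t `^ alpha) ^+ j.
  have iY : P.-integrable setT (EFin \o (fun w => Y w ^+ j)).
    apply/integrableP; split; first exact: mYj.
    under eq_integral => w _ do rewrite /= ger0_norm ?exprn_ge0//.
    by rewrite inverse_process_moment_nat// ltry.
  rewrite /f RintegralZl// /Rintegral inverse_process_moment_nat//= jE.
have sumf : (\sum_(j <oo) \int[P]_w `|f j w|%:E < +oo)%E.
  rewrite (eq_eseriesr (fun j _ => iabs j)) nneseries_EFin ?ltry//.
  apply: entire_cvg_abs; first exact: entire_ml_coef.
  exact: powR_ge0.
have [_ cF] := @integral_series_abs _ _ R P setT f (q \o Y) measurableT mf sumf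
  (fun w _ => hq _ (Y0 w)).
rewrite -(cvg_lim _ cF)// /mittag_leffler; congr (limn _).
by apply/funext => n; rewrite /pseries /series/=; apply: eq_bigr => j _; exact: iR.
Qed.

End expectation_series.

(** * Sums over Omega as coefficients of polynomials *)
Section omega_sum.
Context {R : realType}.
Implicit Types (k n r : nat).

Lemma sum_ord_widen (V : nmodType) m M (F : nat -> V) : (m <= M)%N ->
  (forall i, (m <= i)%N -> F i = 0) -> \sum_(i < m) F i = \sum_(i < M) F i.
Proof.
move=> mM F0; rewrite (big_ord_widen M F mM) big_mkcond/=.
by apply: eq_bigr => i _; case: ltnP => // /F0.
Qed.

Lemma coef_exp_lt (H : {poly R}) n r : H`_0 = 0 -> (n < r)%N -> (H ^+ r)`_n = 0.
Proof.
move=> H0; elim: r n => // r IH n nr; rewrite exprS coefM big1// => -[[|i] /= ilt] _.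
  by rewrite H0 mul0r.
rewrite IH ?mulr0// (@leq_trans n)//.
by rewrite subnS prednK ?subn_gt0// leq_subr.
Qed.

Lemma coef_comp_lt (A H : {poly R}) N n : H`_0 = 0 -> (n < N)%N ->
  (A \Po H)`_n = \sum_(r < N) A`_r * (H ^+ r)`_n.
Proof.
move=> H0 nN; rewrite comp_polyE coef_sum.
under eq_bigr do rewrite coefZ.
pose F r := A`_r * (H ^+ r)`_n.
rewrite (@sum_ord_widen _ _ (maxn (size A) N) F) ?leq_maxl//; last first.
  by move=> i si; rewrite /F nth_default// mul0r.
rewrite (@sum_ord_widen _ N (maxn (size A) N) F) ?leq_maxr//.
by move=> i Ni; rewrite /F coef_exp_lt ?mulr0// (leq_trans nN).
Qed.

(** Exponential series of [h z] in the variable [z] of polynomials over polynomials,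
truncated at degree n. *)
Let expz n (h : {poly R}) : {poly {poly R}} :=
  \poly_(i < n.+1) ((i`!%:R)^-1 *: h ^+ i).

Lemma coef_prod_expz (I : Type) n (s : seq I) (h : I -> {poly R}) r : (r <= n)%N ->
  (\prod_(j <- s) expz n (h j))`_r = (r`!%:R)^-1 *: (\sum_(j <- s) h j) ^+ r.
Proof.
elim: s r => [|j s IH] r rn.
  rewrite !big_nil coef1 expr0n; case: r {rn} => [|r]/=; first by rewrite invr1 scale1r.
  by rewrite scaler0.
rewrite !big_cons coefMr exprDn scaler_sumr; apply: eq_bigr => i _.
have ir : (i <= r)%N by rewrite -ltnS.
rewrite /expz coef_poly ltnS (leq_trans (leq_subr _ _) rn) IH ?(leq_trans ir)//.
have scaleM (a c : R) (p q : {poly R}) : (a *: p) * (c *: q) = (a * c) *: (p * q).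
  by rewrite -scalerAl -scalerAr scalerA.
have natZ (m : nat) (p : {poly R}) : p *+ m = (m%:R : R) *: p by rewrite scaler_nat.
rewrite scaleM natZ scalerA; congr (_ *: _).
have /(congr1 (fun m => m%:R : R)) := bin_fact ir; rewrite natrM => <-.
have F m : m`!%:R != 0 :> R by rewrite pnatr_eq0 -lt0n fact_gt0.
have B : 'C(r, i)%:R != 0 :> R by rewrite pnatr_eq0 -lt0n bin_gt0.
by rewrite natrM; field; rewrite !F B.
Qed.

(** Multinomial expansion: the product of the truncated series
[sum_i (mu_j X^(j+1) z)^i / i!] has one monomial for each tuple, in which the
exponent of [z] is the sum of the entries and the exponent of [X] is the
weighted sum that [Omega] fixes. *)
Lemma sum_Omega k n (mu : 'I_k -> R) (phi : nat -> R) :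
  \sum_(x in Omega k n) phi (\sum_(j < k) x j)%N * \prod_(j < k) (mu j ^+ x j / (x j)`!%:R) =
  \sum_(r < n.+1) phi r / r`!%:R * ((\sum_(j < k) mu j *: 'X^(j.+1)) ^+ r)`_n.
Proof.
pose h (j : 'I_k) : {poly R} := mu j *: 'X^(j.+1).
pose w (x : {ffun 'I_k -> 'I_n.+1}) := \prod_(j < k) (mu j ^+ x j / (x j)`!%:R).
pose z (x : {ffun 'I_k -> 'I_n.+1}) := (\sum_(j < k) x j)%N.
pose v (x : {ffun 'I_k -> 'I_n.+1}) := (\sum_(j < k) j.+1 * x j)%N.
have QE : \prod_(j < k) expz n (h j) =
    \sum_(x : {ffun 'I_k -> 'I_n.+1}) (w x *: 'X^(v x)) *: 'X^(z x).
  under eq_bigr do rewrite /expz poly_def.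
  rewrite bigA_distr_bigA/=; apply: eq_bigr => x _.
  rewrite scaler_prod prodrXr; congr (_ *: _).
  rewrite /w /v -prodrXr -scaler_prod; apply: eq_bigr => j _.
  by rewrite /h exprZn scalerA -exprM mulrC.
transitivity (\sum_(r < n.+1) phi r * ((\prod_(j < k) expz n (h j))`_r)`_n); last first.
  apply: eq_bigr => r _; rewrite coef_prod_expz; last by rewrite -ltnS.
  by rewrite coefZ mulrA.
rewrite QE; under [RHS]eq_bigr do rewrite coef_sum coef_sum big_distrr/=.
rewrite exchange_big/= [LHS]big_mkcond/=; apply: eq_bigr => x _.
rewrite /Omega inE -/(v x) -/(w x) -/(z x).
have zv : (z x <= v x)%N.
  by apply: leq_sum => j _; rewrite leq_pmull.
under eq_bigr do rewrite coefZ coefXn mulrC.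
case: ifPn => vn.
  have zn : (z x < n.+1)%N by rewrite ltnS -(eqP vn).
  rewrite (bigD1 (Ordinal zn))//= eqxx mulr1 coefZ coefXn (eqP vn) eqxx mulr1 big1 ?addr0.
    by rewrite mulrC.
  by move=> r; rewrite -val_eqE/= => /negbTE ->; rewrite mulr0 coef0 mul0r.
rewrite big1// => r _; case: eqP => _; rewrite ?mulr0 ?coef0 ?mul0r//.
by rewrite mulr1 coefZ coefXn eq_sym (negbTE vn) mulr0 mul0r.
Qed.

End omega_sum.

(** * Exponential of a polynomial *)
Section exp_series.
Context {R : realType}.
Implicit Types (A : {poly R}) (y : R).

(** Term [j] of the coefficient of [X^r] in [exp (- y A)]. *)
Definition exp_coef A y (r j : nat) : R := (A ^+ j)`_r * ((- y) ^+ j / j`!%:R).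

(** The hypotheses are the coefficients of [E' = - y A' E]; the series satisfies the
same recursion because [(A^(j+1))' = (j + 1) A' A^j]. *)
Lemma exp_series_jet A y (N : nat) (E : nat -> R) :
  E 0%N = expR (- (y * A`_0)) ->
  (forall r, (r.+1 < N)%N ->
     r.+1%:R * E r.+1 = - y * \sum_(i < r.+1) (A^`())`_i * E (r - i)%N) ->
  forall r, (r < N)%N -> series (exp_coef A y r) @ \oo --> E r.
Proof.
move=> E0 Erec r; elim/ltn_ind: r => -[_ _|r IH rN].
  rewrite E0 /expR.
  rewrite (_ : exp_coef A y 0%N = exp_coeff (- (y * A`_0))); first exact: is_cvg_series_exp_coeff.
  apply/funext => j; rewrite /exp_coef /exp_coeff/= mulrA; congr (_ / _).
  have -> : (A ^+ j)`_0 = A`_0 ^+ j.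
    by elim: j => [|j IH]; rewrite ?expr0 ?coef1// !exprS coef0M IH.
  by rewrite -exprMn mulrN mulrC.
rewrite -cvg_shiftS.
have -> : (fun n => series (exp_coef A y r.+1) n.+1) = (fun n => - y / r.+1%:R *
    \sum_(i < r.+1) (A^`())`_i * series (exp_coef A y (r - i)%N) n).
  apply/funext => n; rewrite /series/= big_nat_recl//= {1}/exp_coef expr0 coef1 mul0r add0r.
  under [in RHS]eq_bigr do rewrite big_distrr/=.
  rewrite exchange_big/= big_distrr/=; apply: eq_bigr => j _.
  have r10 : r.+1%:R != 0 :> R by rewrite pnatr_eq0.
  have j10 : j.+1%:R != 0 :> R by rewrite pnatr_eq0.
  have jf0 : j`!%:R != 0 :> R by rewrite pnatr_eq0 -lt0n fact_gt0.
  have AE : (A ^+ j.+1)`_r.+1 = j.+1%:R / r.+1%:R * (A^`() * A ^+ j)`_r.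
    apply: (mulfI r10); rewrite mulrA mulrCA mulfV// mulr1 mulr_natl -coef_deriv.
    by rewrite deriv_exp coefMn mulr_natl.
  rewrite /exp_coef AE coefM; under [in RHS]eq_bigr do rewrite mulrA.
  rewrite -big_distrl/= factS natrM exprS; set S := \sum_(i < r.+1) _.
  move: S (r.+1%:R) (j.+1%:R) (j`!%:R) r10 j10 jf0 {AE} => S r1 j1 jf r10 j10 jf0.
  by field; rewrite r10 j10 jf0.
have -> : E r.+1 = - y / r.+1%:R * \sum_(i < r.+1) (A^`())`_i * E (r - i)%N.
  apply: (@mulfI _ r.+1%:R); first by rewrite pnatr_eq0.
  by rewrite Erec// mulrA mulrCA mulfV ?mulr1// pnatr_eq0.
apply: cvgMr.
apply: cvg_big => [|i _]; first exact: add_continuous.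
apply: cvgMr; apply: IH.
  by rewrite ltnS leq_subr.
by rewrite (leq_ltn_trans (leq_subr _ _))// ltnW.
Qed.

(** The coefficients of [A^j] up to degree [n] are bounded by the [j]-th power of the
sum of the absolute values of the coefficients of [A] up to degree [n]. *)
Lemma geom_bounded_exp A n : geom_bounded (fun j => (-1) ^+ j * (A ^+ j)`_n).
Proof.
exists 1, (\sum_(m < n.+1) `|A`_m|); split => //; first exact: sumr_ge0.
move=> j; rewrite mul1r normrM normrX normrN1 expr1n mul1r.
suff : forall m, (m <= n)%N -> `|(A ^+ j)`_m| <= (\sum_(i < n.+1) `|A`_i|) ^+ j by apply.
elim: j => [m mn|j IH m mn]; first by rewrite expr0 coef1; case: eqP; rewrite ?normr1 ?normr0.
rewrite !exprS coefM (le_trans (ler_norm_sum _ _ _))//.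
rewrite big_distrl/=.
apply: (@le_trans _ _ (\sum_(i < m.+1) `|A`_i| * (\sum_(i < n.+1) `|A`_i|) ^+ j)).
  apply: ler_sum => i _; rewrite normrM ler_wpM2l// IH//.
  by rewrite (leq_trans (leq_subr _ _)).
rewrite (big_ord_widen n.+1 (fun i => `|A`_i| * (\sum_(i < n.+1) `|A`_i|) ^+ j))//.
rewrite big_mkcond/=; apply: ler_sum => i _; case: ifP => // _.
by rewrite mulr_ge0// exprn_ge0// sumr_ge0.
Qed.

End exp_series.

(** * Higher derivatives on the half-line *)
Section smooth.
Context {R : realType}.
Implicit Types (g h f : R -> R) (s y : R).

Lemma near_pos s : 0 < s -> \forall x \near s, 0 < x.
Proof. by move=> s0; exact: lt_nbhsr. Qed.

Lemma derivable_eq_pos g h s : (forall x, 0 < x -> g x = h x) -> 0 < s ->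
  derivable g s 1 -> derivable h s 1.
Proof.
move=> gh s0; apply: near_eq_derivable => //.
by apply: filterS (near_pos s0) => x; exact: gh.
Qed.

Lemma derive1_eq_pos g h s : (forall x, 0 < x -> g x = h x) -> 0 < s ->
  derive1 g s = derive1 h s.
Proof.
move=> gh s0; rewrite !derive1E; apply: near_eq_derive => //.
by apply: filterS (near_pos s0) => x; exact: gh.
Qed.

Lemma derive1n_eq_pos g h r s : (forall x, 0 < x -> g x = h x) -> 0 < s ->
  derive1n r g s = derive1n r h s.
Proof.
move=> gh; elim: r s => [|r IH] s s0; first exact: gh.
by rewrite !derive1nS; apply: derive1_eq_pos.
Qed.

(** [n] times differentiable on the positive half-line; at [0] the exponent
of a subordinator need not be differentiable. *)
Fixpoint Ck (n : nat) g : Prop :=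
  if n is m.+1 then (forall s, 0 < s -> derivable g s 1) /\ Ck m (derive1 g) else True.

Definition smooth_pos g := forall n, Ck n g.

Lemma Ck_eq n g h : (forall x, 0 < x -> g x = h x) -> Ck n g -> Ck n h.
Proof.
elim: n g h => //= n IH g h gh [dg cg]; split.
  by move=> s s0; apply: derivable_eq_pos gh s0 (dg s s0).
by apply: IH cg => x x0; exact: derive1_eq_pos.
Qed.

Lemma CkW n g : Ck n.+1 g -> Ck n g.
Proof. by elim: n g => // n IH g [dg cg]; split => //; exact: IH. Qed.

Lemma CkD n g h : Ck n g -> Ck n h -> Ck n (fun x => g x + h x).
Proof.
elim: n g h => // n IH g h [dg cg] [dh ch]; split.
  by move=> s s0; apply: derivableD; [exact: dg|exact: dh].
apply: Ck_eq (IH _ _ cg ch) => x x0.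
by rewrite [RHS]derive1E deriveD ?derive1E//; [exact: dg|exact: dh].
Qed.

Lemma CkM n g h : Ck n g -> Ck n h -> Ck n (fun x => g x * h x).
Proof.
elim: n g h => // n IH g h cgS chS.
have [dg cg] := cgS; have [dh ch] := chS; split.
  by move=> s s0; apply: derivableM; [exact: dg|exact: dh].
have c1 := IH _ _ (CkW cgS) ch; have c2 := IH _ _ (CkW chS) cg.
apply: Ck_eq (CkD c1 c2) => x x0.
by rewrite [RHS]derive1E deriveM ?derive1E//; [exact: dg|exact: dh].
Qed.

Lemma Ck_cst n (c : R) : Ck n (fun=> c).
Proof.
elim: n c => // n IH c; split; first by move=> s _; exact: derivable_cst.
by apply: Ck_eq (IH 0) => x _; rewrite derive1E derive_cst.
Qed.

Lemma Ck_expR n h : Ck n h -> Ck n (fun x => expR (h x)).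
Proof.
elim: n h => // n IH h chS; have [dh ch] := chS.
have De (x : R) : 0 < x -> is_derive x (1:R) (fun x => expR (h x)) (expR (h x) * derive1 h x).
  move=> x0; have d : is_derive x (1:R) h (derive1 h x).
    by rewrite derive1E; apply/derivableP; exact: dh.
  exact: (is_derive1_comp (is_derive_expR (h x)) d).
split; first by move=> s s0; have d := De s s0; exact: ex_derive.
apply: Ck_eq (CkM (IH _ (CkW chS)) ch) => x x0.
by rewrite [RHS]derive1E; have d := De x x0; rewrite derive_val.
Qed.

Lemma smooth_derivable g : smooth_pos g ->
  forall r s, 0 < s -> derivable (derive1n r g) s 1.
Proof.
move=> cg r; have := cg r.+1; elim: r g {cg} => [|r IH] g; first by case.
by move=> [_ cg] s s0; rewrite /derive1n iterSr; exact: IH.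
Qed.

(** A tower is a sequence of functions each of which is the derivative of the previous
one. *)
Lemma derive1n_tower (G : nat -> R -> R) h :
  (forall r s, 0 < s -> is_derive s (1:R) (G r) (G r.+1 s)) ->
  (forall s, 0 < s -> h s = G 0%N s) ->
  forall r s, 0 < s -> derive1n r h s = G r s.
Proof.
move=> dG hG; elim=> [|r IH] s s0; first exact: hG.
rewrite derive1nS (derive1_eq_pos IH s0) derive1E.
by have d := dG r s s0; rewrite derive_val.
Qed.

Lemma Ck_tower (G : nat -> R -> R) n r :
  (forall r s, 0 < s -> is_derive s (1:R) (G r) (G r.+1 s)) -> Ck n (G r).
Proof.
move=> dG; elim: n r => // n IH r; split.
  by move=> s s0; have d := dG r s s0; exact: ex_derive.
apply: Ck_eq (IH r.+1) => x x0.
by rewrite derive1E; have d := dG r x x0; rewrite derive_val.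
Qed.

(** [f' = - G_1 exp f], so each order of smoothness of [f] gives the next one. *)
Lemma smooth_exponent (G : nat -> R -> R) f :
  (forall r s, 0 < s -> is_derive s (1:R) (G r) (G r.+1 s)) ->
  (forall s, 0 < s -> expR (- f s) = G 0%N s) -> smooth_pos f.
Proof.
move=> dG fG.
have fln s : 0 < s -> - ln (G 0%N s) = f s by move=> s0; rewrite -fG// expRK opprK.
have G0 s : 0 < s -> 0 < G 0%N s by move=> s0; rewrite -fG// expR_gt0.
have Df s : 0 < s -> is_derive s (1:R) f (- (G 1%N s * expR (f s))).
  move=> s0.
  have d1 : is_derive s (1:R) (fun x => ln (G 0%N x)) ((G 0%N s)^-1 * G 1%N s).
    exact: (is_derive1_comp (is_derive1_ln (G0 s s0)) (dG 0%N s s0)).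
  have d2 : is_derive s (1:R) (fun x => - ln (G 0%N x)) (- ((G 0%N s)^-1 * G 1%N s)).
    exact: is_deriveN.
  rewrite mulrC (_ : expR (f s) = (G 0%N s)^-1); last by rewrite -fG// expRN invrK.
  apply: near_eq_is_derive d2.
  by apply: filterS (near_pos s0) => x; exact: fln.
elim=> // n IH; split; first by move=> s s0; have d := Df s s0; exact: ex_derive.
apply: Ck_eq (CkM (Ck_cst n (-1)) (CkM (Ck_tower n 1 dG) (Ck_expR IH))) => x x0.
by rewrite derive1E; have d := Df x x0; rewrite derive_val mulN1r.
Qed.

(** Taylor coefficients: in this normalization Leibniz' rule [jetM] is the product of
polynomials. *)
Definition jet g s r : R := derive1n r g s / r`!%:R.

Let fact0 (r : nat) : r`!%:R != 0 :> R.
Proof. by rewrite pnatr_eq0 -lt0n fact_gt0. Qed.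

Lemma jet_derive1 g s r : jet (derive1 g) s r = r.+1%:R * jet g s r.+1.
Proof.
rewrite /jet /derive1n iterSr factS natrM.
have r10 : r.+1%:R != 0 :> R by rewrite pnatr_eq0.
have := fact0 r; move: (r`!%:R : R) (r.+1%:R : R) r10 => a c c0 a0.
by field; rewrite a0 c0.
Qed.

Lemma is_derive_jet g s r : smooth_pos g -> 0 < s ->
  is_derive s (1:R) (fun s => jet g s r) (r.+1%:R * jet g s r.+1).
Proof.
move=> sg s0; rewrite -jet_derive1 /jet.
have d : is_derive s (1:R) (derive1n r g) (derive1n r.+1 g s).
  by rewrite derive1nS derive1E; apply/derivableP; exact: smooth_derivable.
rewrite {2}/derive1n -iterSr -/(derive1n _ _).
have := is_deriveM d (@is_derive_cst R R R (r`!%:R^-1) s 1).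
by rewrite scaler0 add0r [_ *: _]mulrC.
Qed.

Lemma jetM g h r s : smooth_pos g -> smooth_pos h -> 0 < s ->
  jet (fun x => g x * h x) s r = \sum_(i < r.+1) jet g s i * jet h s (r - i)%N.
Proof.
move=> sg sh; elim: r s => [|r IH] s s0.
  by rewrite big_ord_recl big_ord0 addr0 subn0 /jet /= !divr1.
have sgh : smooth_pos (fun x => g x * h x) by move=> n; exact: CkM.
pose ds (i : 'I_r.+1) := jet g s i * ((r - i).+1%:R * jet h s (r - i).+1) +
  jet h s (r - i)%N * (i.+1%:R * jet g s i.+1).
have dS : is_derive s (1:R) (fun x => \sum_(i < r.+1) jet g x i * jet h x (r - i)%N)
    (\sum_(i < r.+1) ds i).
  rewrite (_ : (fun x => _) = \sum_(i < r.+1) (fun x => jet g x i * jet h x (r - i)%N)).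
    apply: is_derive_sum => i.
    exact: (is_deriveM (is_derive_jet i sg s0) (is_derive_jet (r - i) sh s0)).
  by apply/funext => x; rewrite fct_sumE.
have d2 : is_derive s (1:R) (fun x => jet (fun x => g x * h x) x r) (\sum_(i < r.+1) ds i).
  apply: near_eq_is_derive dS.
  by apply: filterS (near_pos s0) => x x0; rewrite IH.
apply: (@mulfI _ r.+1%:R); first by rewrite pnatr_eq0.
have [_ <-] := is_derive_jet r sgh s0; have [_ ->] := d2.
rewrite /ds {ds dS d2} big_split/= big_distrr/=.
pose F i := jet g s i * jet h s (r.+1 - i)%N.
transitivity (\sum_(i < r.+2) i%:R * F i + \sum_(i < r.+2) (r.+1 - i)%:R * F i); last first.
  rewrite -big_split/=; apply: eq_bigr => i _; rewrite -mulrDl -natrD.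
  by rewrite subnKC// -ltnS.
rewrite addrC; congr (_ + _).
  rewrite [RHS]big_ord_recl/= mulr0n mul0r add0r; apply: eq_bigr => i _.
  by rewrite /F /bump/= add1n subSS; ring.
rewrite [RHS]big_ord_recr/= subnn mulr0n mul0r addr0; apply: eq_bigr => i _.
rewrite /F subSn -1?ltnS//; ring.
Qed.

Lemma derive1n_cst (c : R) r : derive1n r.+1 (fun=> c : R) = (fun=> 0).
Proof.
elim: r => [|r IH]; apply/funext => x; last by rewrite derive1nS IH derive1E derive_cst.
by rewrite derive1n1 derive1E derive_cst.
Qed.

Lemma jetZ g (c : R) r s : smooth_pos g -> 0 < s ->
  jet (fun x => c * g x) s r = c * jet g s r.
Proof.
move=> sg s0; rewrite (jetM _ (fun n => Ck_cst n c) sg s0).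
rewrite big_ord_recl/= {1}/jet/= divr1 subn0 big1 ?addr0// => i _.
by rewrite /jet /bump add1n derive1n_cst !mul0r.
Qed.

(** Leibniz' rule in [(exp (- y f))' = - y f' exp (- y f)]. *)
Lemma jet_exp_rec f y r s : smooth_pos f -> 0 < s ->
  r.+1%:R * jet (fun x => expR (- (y * f x))) s r.+1 =
  - y * \sum_(i < r.+1) (i.+1%:R * jet f s i.+1) *
      jet (fun x => expR (- (y * f x))) s (r - i)%N.
Proof.
move=> sf s0; rewrite -jet_derive1.
pose E x := expR (- (y * f x)); rewrite -/E.
have sE : smooth_pos E.
  move=> n; apply: Ck_eq (Ck_expR (CkM (Ck_cst n (- y)) (sf n))) => x _.
  by rewrite /E mulNr.
have sf' : smooth_pos (derive1 f) by move=> n; have [] := sf n.+1.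
have sfE : smooth_pos (fun x => derive1 f x * E x) by move=> n; exact: CkM.
transitivity (jet (fun x => - y * (derive1 f x * E x)) s r).
  rewrite /jet; congr (_ / _); apply: derive1n_eq_pos => // x x0.
  have d1 : is_derive x (1:R) (fun x => - (y * f x)) (- (y * derive1 f x)).
    apply: is_deriveN; have df : is_derive x (1:R) f (derive1 f x).
      have [df _] : Ck 1 f := sf 1%N.
      by rewrite derive1E; apply/derivableP; exact: df.
    exact: is_deriveZ.
  have d2 := @is_derive1_comp R expR (fun x => - (y * f x)) x _ _ (is_derive_expR (- (y * f x))) d1.
  by rewrite derive1E; case: d2 => _ /= ->; rewrite -/(E x); ring.
rewrite jetZ// jetM//; congr (_ * _); apply: eq_bigr => i _.
by rewrite jet_derive1.
Qed.

End smooth.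

(** * Laplace transform of a subordinator and its derivatives *)
Section expectation_exp.
Context d (T : measurableType d) {R : realType} (P : probability T R).

(** A term of the exponential series of [a x] is at most its sum. *)
Lemma expr_expR_le (a s x : R) r : 0 < a -> a <= s -> 0 <= x ->
  x ^+ r * expR (- (s * x)) <= r`!%:R / a ^+ r.
Proof.
move=> a0 as_ x0; apply: (@le_trans _ _ (x ^+ r * expR (- (a * x)))).
  by rewrite ler_wpM2l ?exprn_ge0// ler_expR lerN2 ler_wpM2r.
have ax0 : 0 <= a * x by rewrite mulr_ge0// ltW.
have f0 : 0 < r`!%:R :> R by rewrite ltr0n fact_gt0.
rewrite expRN ler_pdivrMr ?expR_gt0// mulrAC ler_pdivlMr ?exprn_gt0// -exprMn mulrC -ler_pdivrMl//.
rewrite [_^-1 * _]mulrC.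
case: r f0 => [|r] f0; first by rewrite divr1 expr0 -expR0 ler_expR.
by apply: le_trans (expR_ge1Dxn r ax0); rewrite lerDr.
Qed.

Section tower.
Variable X : T -> R.
Hypothesis mX : measurable_fun setT X.
Hypothesis X0 : forall w, 0 <= X w.

(** Formally the [r]-th derivative in [s] of the Laplace transform of [X]. *)
Definition exp_moment r s : R := \int[P]_w ((- X w) ^+ r * expR (- (s * X w))).

Let F r s w := (- X w) ^+ r * expR (- (s * X w)).

Let normF (a s : R) r w : 0 < a -> a <= s -> `|F r s w| <= r`!%:R / a ^+ r.
Proof.
move=> a0 as_; rewrite /F normrM normrX normrN (ger0_norm (X0 w)).
by rewrite (ger0_norm (expR_ge0 _)) expr_expR_le.
Qed.

Let measurable_F r s : measurable_fun setT (F r s).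
Proof.
apply: measurable_funM; first by apply: measurable_funX; exact: measurableT_comp.
apply: (measurableT_comp (@measurable_expR R)); apply: measurableT_comp => //.
exact: measurable_funM.
Qed.

Lemma integrable_exp_moment r s : 0 < s -> P.-integrable setT (EFin \o F r s).
Proof.
move=> s0; apply: le_integrable (finite_measure_integrable_cst P (r`!%:R / s ^+ r) measurableT).
- exact: measurableT.
- exact/measurable_EFinP.
- by move=> w _ /=; rewrite lee_fin (le_trans (normF _ _ s0 (lexx s)))// ler_norm.
Qed.

(** Differentiation under the integral on [[s / 2, s + 1]], where the derivative of
the integrand is bounded by a constant. *)
Lemma is_derive_exp_moment r (s : R) : 0 < s ->
  is_derive s (1:R) (exp_moment r) (exp_moment r.+1 s).
Proof.
move=> s0.
have dF (x : R) w : is_derive x (1:R) (fun s => F r s w) (F r.+1 x w).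
  have d1 : is_derive x (1:R) (fun s => - (s * X w)) (- X w).
    have d0 : is_derive x (1:R) (fun s => s * X w) (X w).
      have := is_deriveM (@is_derive_id _ _ x (1:R)) (@is_derive_cst R R R (X w) x 1).
      by rewrite scaler0 add0r /= [_ *: _]mulr1.
    exact: is_deriveN.
  have d2 := @is_derive1_comp R expR (fun s => - (s * X w)) x _ _ (is_derive_expR (- (x * X w))) d1.
  have d3 := @is_deriveZ R R R (fun s => expR (- (s * X w))) ((- X w)^+ r) x 1 _ d2.
  have -> : F r.+1 x w = (- X w)^+ r *: (expR (- (x * X w)) * - X w).
    by rewrite /F exprS /GRing.scale/=; ring.
  exact: d3.
have Is : `]s / 2, s + 1[%classic s by rewrite /= in_itv/=; apply/andP; split; lra.
have s20 : 0 < s / 2 by lra.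
have i1 x : `]s / 2, s + 1[%classic x -> P.-integrable setT (EFin \o F r x).
  rewrite /= in_itv/= => /andP[sx _]; apply: integrable_exp_moment; lra.
have i2 x w : `]s / 2, s + 1[%classic x -> setT w -> derivable (fun s => F r s w) x 1.
  by move=> _ _; have d1 := dF x w; exact: ex_derive.
pose G (w : T) : R := (r.+1)`!%:R / (s / 2) ^+ r.+1.
have i3 w : 0 <= G w by rewrite divr_ge0// exprn_ge0// ltW.
have i4 : P.-integrable setT (EFin \o G) by exact: finite_measure_integrable_cst.
have pE x w : partial1of2 (F r) x w = F r.+1 x w.
  by rewrite partial1of2E; have d1 := dF x w; rewrite derive_val.
have i5 x w : `]s / 2, s + 1[%classic x -> setT w -> `|partial1of2 (F r) x w| <= G w.
  rewrite pE /= in_itv/= => /andP[sx _] _; apply: normF => //; exact: ltW.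
have D1 := @derivable_under_integral _ _ _ P _ _ measurableT _ _ _ Is i1 i2 _ i3 i4 i5.
have D2 := @differentiation_under_integral _ _ _ P _ _ measurableT _ _ _ Is i1 i2 _ i3 i4 i5.
rewrite (_ : exp_moment r.+1 s = derive1 (exp_moment r) s).
  by rewrite derive1E; apply/derivableP.
by rewrite [RHS]D2; apply: eq_Rintegral => w _; rewrite pE.
Qed.

End tower.

Section subordinator_exponent.
Variables (f : R -> R) (Df : R -> T -> R).
Hypothesis subf : subordinator P f Df.

Lemma measurable_subordinator t : 0 <= t -> measurable_fun setT (Df t).
Proof. by case: subf => -[h _ _ _] _ _; exact: h. Qed.

Lemma subordinator_homo w s t : 0 <= s -> s <= t -> Df s w <= Df t w.
Proof. by case: subf => _ h _; exact: h. Qed.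

Lemma subordinator_ge0 w t : 0 <= t -> 0 <= Df t w.
Proof. by case: subf => -[_ D0 _ _] _ _ t0; rewrite -(D0 w) subordinator_homo. Qed.

Lemma exp_moment0 y s : 0 <= y -> 0 < s -> exp_moment (Df y) 0 s = expR (- (y * f s)).
Proof.
move=> y0 s0; rewrite /exp_moment /Rintegral.
case: subf => _ _ /(_ s y (ltW s0) y0); rewrite unlock => h.
rewrite (_ : integral _ _ _ = (expR (- (y * f s)))%:E)// -h.
by apply: eq_integral => w _; rewrite expr0 mul1r.
Qed.

Lemma exponent_smooth : smooth_pos f.
Proof.
apply: (@smooth_exponent _ (exp_moment (Df 1))) => [r s s0|s s0].
  apply: is_derive_exp_moment s0; first exact: measurable_subordinator.
  by move=> w; exact: subordinator_ge0.
by rewrite exp_moment0// mul1r.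
Qed.

Lemma exp_moment_jet (y : R) r (s : R) : 0 <= y -> 0 < s ->
  exp_moment (Df y) r s = derive1n r (fun s => expR (- (y * f s))) s.
Proof.
move=> y0 s0; have dG r' (x : R) : 0 < x -> is_derive x (1:R) (exp_moment (Df y) r') (exp_moment (Df y) r'.+1 x).
  move=> x0; apply: is_derive_exp_moment x0; first exact: measurable_subordinator.
  by move=> w; exact: subordinator_ge0.
symmetry; apply: (derive1n_tower dG) => //.
by move=> x x0; rewrite exp_moment0.
Qed.

End subordinator_exponent.
End expectation_exp.

(** * State probabilities at an independent subordinated time *)
Section state_series.
Context d (T : measurableType d) {R : realType} (P : probability T R).
Variables (k : nat) (lambda : 'I_k -> R) (f : R -> R) (Df : R -> T -> R).
Hypothesis subf : subordinator P f Df.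
Hypothesis Lambda0 : 0 < total_rate lambda.
Local Notation Lambda := (total_rate lambda).

Definition count_prob (n : nat) (x : R) : R :=
  \sum_(z in Omega k n) (\prod_(j < k) ((lambda j * x) ^+ z j / (z j)`!%:R)) * expR (- (Lambda * x)).

Definition jump_poly : {poly R} := \sum_(j < k) (- lambda j) *: 'X^(j.+1).

Definition jet_poly N : {poly R} := \poly_(i < N) jet f Lambda i.

Definition rate_poly N : {poly R} := jet_poly N \Po jump_poly.

(** The sign is that of [exp (- y C)], in which the coefficient of [X^n] is the sum of
the [state_coef N n j * y^j / j!].  The truncation at degree [N] is harmless for
[n < N]; a common [N] lets all states up to [n] share one polynomial. *)
Definition state_coef N (n j : nat) : R := (-1) ^+ j * (rate_poly N ^+ j)`_n.

Lemma jump_poly0 : jump_poly`_0 = 0.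
Proof. by rewrite coef_sum big1// => j _; rewrite coefZ coefXn mulr0. Qed.

Lemma rate_polyE N m : (m < N)%N -> (rate_poly N)`_m =
  \sum_(x in Omega k m) derive1n (\sum_(j < k) x j)%N f Lambda
           * (\prod_(j < k) ((- lambda j) ^+ x j / (x j)`!%:R)).
Proof.
move=> mN; rewrite (@sum_Omega _ k m (fun j => - lambda j) (fun r => derive1n r f Lambda)).
rewrite (coef_comp_lt _ jump_poly0 (ltnSn m)); apply: eq_bigr => r _.
by rewrite coef_poly (leq_ltn_trans _ mN)// -ltnS.
Qed.

Lemma rate_poly0 N : (0 < N)%N -> (rate_poly N)`_0 = f Lambda.
Proof.
move=> N0; rewrite (coef_comp_lt _ jump_poly0 (ltnSn 0)) big_ord_recl big_ord0 addr0.
by rewrite coef_poly N0 expr0 coef1 mulr1 /jet /= divr1.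
Qed.

Lemma state_coef0 N n : state_coef N n 0 = (n == 0%N)%:R.
Proof. by rewrite /state_coef !expr0 mul1r coef1. Qed.

Lemma state_coefS N n j : state_coef N n j.+1 =
  - \sum_(i < n.+1) (rate_poly N)`_i * state_coef N (n - i) j.
Proof.
rewrite /state_coef exprS [rate_poly N ^+ _]exprS coefM mulN1r mulNr; congr (- _).
by rewrite big_distrr/=; apply: eq_bigr => i _; rewrite mulrCA.
Qed.

Lemma Rintegral_sum (I : Type) (s : seq I) (g : I -> T -> R) :
  (forall i, P.-integrable setT (EFin \o g i)) ->
  \int[P]_w (\sum_(i <- s) g i w) = \sum_(i <- s) \int[P]_w g i w.
Proof.
move=> ig; elim: s => [|i s IH].
  under eq_Rintegral do rewrite big_nil.
  by rewrite big_nil Rintegral_cst// mul0r.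
rewrite big_cons -IH -RintegralD//; last first.
  have -> : EFin \o (fun w => \sum_(i <- s) g i w) = (fun w => \sum_(i <- s) (EFin \o g i) w)%E.
    by apply/funext => w; rewrite /= sumEFin.
  exact: integrable_sum.
by apply: eq_Rintegral => w _; rewrite big_cons.
Qed.

(** In each term of the law of [M] the powers of [x] and the exponential combine into
the integrand of [exp_moment]; the signs of [- lambda j] and [- Df y] cancel. *)
Lemma expectation_count_prob n y : 0 <= y ->
  \int[P]_w count_prob n (Df y w) =
  \sum_(r < n.+1) jet (fun s => expR (- (y * f s))) Lambda r * (jump_poly ^+ r)`_n.
Proof.
move=> y0.
have ie r : P.-integrable setT (EFin \o (fun w => (- Df y w) ^+ r * expR (- (Lambda * Df y w)))).
  apply: integrable_exp_moment => //; first exact: (measurable_subordinator subf).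
  by move=> w; exact: (subordinator_ge0 subf).
transitivity (\sum_(x in Omega k n) exp_moment P (Df y) (\sum_(j < k) x j)%N Lambda *
   \prod_(j < k) ((- lambda j) ^+ x j / (x j)`!%:R)); last first.
  rewrite (@sum_Omega _ k n (fun j => - lambda j) (fun r => exp_moment P (Df y) r Lambda)).
  by apply: eq_bigr => r _; rewrite (exp_moment_jet subf).
transitivity (\int[P]_w (\sum_(x <- enum (Omega k n))
   ((\prod_(j < k) ((- lambda j) ^+ x j / (x j)`!%:R)) *
    ((- Df y w) ^+ (\sum_(j < k) x j)%N * expR (- (Lambda * Df y w)))))).
  apply: eq_Rintegral => w _; rewrite big_enum; apply: eq_bigr => z _; rewrite mulrA; congr (_ * _).
  rewrite -prodrXr -big_split/=; apply: eq_bigr => j _.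
  by rewrite mulrAC -exprMn mulrNN.
rewrite Rintegral_sum.
  by rewrite big_enum; apply: eq_bigr => z _; rewrite RintegralZl// mulrC.
move=> z; set c := \prod_(j < k) _; have := integrableZl measurableT c (ie (\sum_(j < k) z j)%N).
by apply: eq_integrable => // w _; rewrite /= EFinM.
Qed.

(** The jets of [exp (- y f)] are the coefficients of [exp (- y A)], [A] the Taylor
polynomial of [f], and the sum over [r] carries out the substitution of
[jump_poly] in [A]. *)
Lemma state_series N n y : (n < N)%N -> 0 <= y ->
  series (fun j => state_coef N n j / j`!%:R * y ^+ j) @ \oo -->
    \int[P]_w count_prob n (Df y w).
Proof.
move=> nN y0; rewrite expectation_count_prob//.
pose E r := jet (fun s => expR (- (y * f s))) Lambda r.
have N0 : (0 < N)%N by exact: leq_trans nN.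
have jc i : (i < N)%N -> (jet_poly N)`_i = jet f Lambda i by move=> iN; rewrite coef_poly iN.
have E0 : E 0%N = expR (- (y * (jet_poly N)`_0)) by rewrite jc// /E /jet /= !divr1.
have Er r : (r.+1 < N)%N ->
     r.+1%:R * E r.+1 = - y * \sum_(i < r.+1) ((jet_poly N)^`())`_i * E (r - i)%N.
  move=> rN; rewrite /E jet_exp_rec//; last exact: (exponent_smooth subf).
  congr (_ * _); apply: eq_bigr => i _; congr (_ * _).
  by rewrite coef_deriv jc ?mulr_natl// (leq_ltn_trans _ rN).
have cE := exp_series_jet E0 Er.
have cS : (fun J => \sum_(r < n.+1) series (exp_coef (jet_poly N) y r) J * (jump_poly ^+ r)`_n) @ \oo -->
    \sum_(r < n.+1) E r * (jump_poly ^+ r)`_n.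
  apply: cvg_big => [|r _]; first exact: add_continuous.
  apply: cvgMl; apply: cE.
  by rewrite (leq_trans _ nN).
apply: cvg_trans cS; apply: near_eq_cvg; apply: nearW => J.
rewrite /series/=; under eq_bigr do rewrite big_distrl/=.
rewrite exchange_big/=; apply: eq_bigr => j _.
rewrite /state_coef /rate_poly -rmorphXn/= (coef_comp_lt _ jump_poly0 (ltnSn n)).
rewrite big_distrr !big_distrl/=; apply: eq_bigr => r _.
by rewrite /exp_coef [(- y) ^+ j]exprNn; ring.
Qed.

End state_series.

(** * Bounded random variables *)
Section bounded.
Context d (T : measurableType d) {R : realType} (P : probability T R).

Definition unit_bounded (g : T -> R) := measurable_fun setT g /\ forall w, 0 <= g w <= 1.

Lemma unit_bounded_integrable g : unit_bounded g -> P.-integrable setT (EFin \o g).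
Proof.
move=> [mg g01]; apply: le_integrable (finite_measure_integrable_cst P 1 measurableT).
- exact: measurableT.
- exact/measurable_EFinP.
- move=> w _ /=; have /andP[g0 g1] := g01 w.
  by rewrite lee_fin normr1 ger0_norm.
Qed.

Lemma unit_bounded_integral g : unit_bounded g ->
  (\int[P]_w (g w)%:E = (\int[P]_w g w)%:E)%E.
Proof.
move=> ug; rewrite /Rintegral fineK//.
exact: integrable_fin_num (unit_bounded_integrable ug).
Qed.

Lemma unit_bounded_mean g : unit_bounded g -> 0 <= \int[P]_w g w <= 1.
Proof.
move=> ug; have [mg g01] := ug.
have g0 w : 0 <= g w by have /andP[] := g01 w.
rewrite Rintegral_ge0//=.
rewrite -lee_fin -unit_bounded_integral//.
apply: (@le_trans _ _ (\int[P]_w (cst 1%:E w))%E).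
  apply: ge0_le_integral => //.
  - by move=> w _; rewrite lee_fin.
  - exact/measurable_EFinP.
  - by move=> w _; rewrite lee_fin; have /andP[] := g01 w.
by rewrite integral_cst// mul1e probability_le1.
Qed.

Lemma unit_bounded_cvg (g_ : nat -> T -> R) g : (forall n, unit_bounded (g_ n)) ->
  (forall w, g_ n w @[n --> \oo] --> g w) ->
  \int[P]_w g_ n w @[n --> \oo] --> \int[P]_w g w.
Proof.
move=> ug cg.
have mg : measurable_fun setT g.
  by apply: (@measurable_fun_cvg _ _ _ _ g_) => [n|w _]; [case: (ug n)|exact: cg].
have ug' : unit_bounded g.
  split => // w; apply/andP; split.
    by apply: (cvgr_to_ge (cg w)); apply: nearW => n; case: (ug n) => _ /(_ w)/andP[].
  by apply: (cvgr_to_le (cg w)); apply: nearW => n; case: (ug n) => _ /(_ w)/andP[].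
apply: fine_cvg; rewrite -unit_bounded_integral//.
apply: (@dominated_cvg _ _ _ P _ measurableT (fun n w => (g_ n w)%:E) _ (cst 1%:E)) => //.
- by move=> n; apply/measurable_EFinP; case: (ug n).
- by move=> w _; apply: cvg_EFin; [exact: nearW|exact: cg].
- exact: (finite_measure_integrable_cst P 1 measurableT).
- move=> n w _; have /andP[g0 g1] := (ug n).2 w.
  by rewrite lee_fin ger0_norm.
Qed.

End bounded.

(** * Conditioning on a discrete random variable *)
Section freezing.
Context d (T : measurableType d) {R : realType} (P : probability T R).

Let level (U : T -> nat) i := [set w | U w = i].

Let level_cover U : \bigcup_i level U i = setT.
Proof. by apply/seteqP; split=> w // _; exists (U w). Qed.

Let level_trivIset U : trivIset setT (level U).
Proof.
apply/trivIsetP => i j _ _ /eqP ij; rewrite -subset0 => w [/= Ui Uj].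
by apply: ij; rewrite -Ui -Uj.
Qed.

Lemma measurable_index_comp e (V : measurableType e) (U : T -> nat) (F : nat -> V) :
  (forall i, measurable [set w | U w = i]) -> measurable_fun setT (fun w => F (U w)).
Proof.
move=> mU; rewrite -(level_cover U); apply/measurable_fun_bigcup => // i.
apply: (@eq_measurable_fun _ _ _ _ _ (cst (F i))) => // w; rewrite inE /level/= => ->//.
Qed.

Lemma prob_bigcup_level (U : T -> nat) (B : nat -> set T) :
  (forall i, measurable [set w | U w = i]) -> (forall i, measurable (B i)) ->
  P [set w | B (U w) w] = (\sum_(i <oo) P ([set w | U w = i] `&` B i))%E.
Proof.
move=> mU mB; rewrite (_ : mkset _ = \bigcup_i (level U i `&` B i)); last first.
  by apply/seteqP; split=> [w Bw|w [i _ [<-]]]//; exists (U w).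
rewrite measure_semi_bigcup//.
- by move=> i; apply: measurableI; [exact: mU|exact: mB].
- apply/trivIsetP => i j _ _ ij; have /trivIsetP/(_ i j I I ij) := level_trivIset (U := U).
  by move=> e; rewrite setIACA e set0I.
- by apply: bigcupT_measurable => i; apply: measurableI; [exact: mU|exact: mB].
Qed.

(** Substitution of a discrete random index [U] in a family of events, each of which
is independent of the value of [U] that selects it: the events [U = i] partition
the space. *)
Lemma prob_freeze (U : T -> nat) (B : nat -> set T) :
  (forall i, measurable [set w | U w = i]) -> (forall i, measurable (B i)) ->
  (forall i, P ([set w | U w = i] `&` B i) = (P [set w | U w = i] * P (B i))%E) ->
  P [set w | B (U w) w] = (\int[P]_w P (B (U w)))%E.
Proof.
move=> mU mB ind; rewrite prob_bigcup_level// -(level_cover U).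
rewrite ge0_integral_bigcup//.
- apply: eq_eseriesr => i _; rewrite ind muleC -integral_cst//.
  by apply: eq_integral => w; rewrite inE /level/= => ->.
- rewrite level_cover; exact: (@measurable_index_comp _ _ U (fun i => P (B i))).
Qed.

End freezing.

(** * The law of the process at a random time *)
Section conditioning.
Context d (T : measurableType d) {R : realType} (P : probability T R).
Variables (k : nat) (lambda : 'I_k -> R) (f : R -> R).
Variables (M : R -> T -> nat) (Df Y : R -> T -> R).
Hypothesis cM : counting_process P lambda M.
Hypothesis subf : subordinator P f Df.
Hypothesis mY : forall t, measurable_fun setT (Y t).
Hypothesis Y0 : forall t w, 0 <= Y t w.
Hypothesis ind : independent3 P (fun t w => (M t w)%:R) Df Y.

Let X t w : R := (M t w)%:R.

Let mX t : 0 <= t -> measurable_fun setT (X t).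
Proof. by case: cM => -[h _ _ _] _; exact: h. Qed.

Let cX w : cadlag (X ^~ w).
Proof. by case: cM => -[_ _ h _] _; exact: h. Qed.

Let cD w : cadlag (Df ^~ w).
Proof. by case: subf => -[_ _ h _] _ _; exact: h. Qed.

Let state_preimage (Z : T -> nat) n : [set w | Z w = n] = (fun w => (Z w)%:R : R) @^-1` [set n%:R].
Proof. by apply/seteqP; split=> w /=; [move=> ->|move=> /eqP; rewrite eqr_nat => /eqP]. Qed.

Lemma process_sigma_preimage (Z : R -> T -> R) t B : 0 <= t -> measurable B ->
  process_sigma Z (Z t @^-1` B).
Proof.
move=> t0 mB; apply: sub_sigma_algebra; exists t => //; exists B => //.
by rewrite setTI.
Qed.

Lemma process_sigma_index (Z : R -> T -> R) t m i : 0 <= t ->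
  process_sigma Z [set w | grid_index m (Z t w) = i].
Proof.
move=> t0; pose B : set R := [set x | grid_index m x = i].
exact: (@process_sigma_preimage Z t B t0 (measurable_grid_index m i)).
Qed.

Lemma process_sigmaT (Z : R -> T -> R) : process_sigma Z setT.
Proof. by rewrite -(preimage_setT (Z 0)); exact: process_sigma_preimage. Qed.

Lemma independent3E (A B C : set T) : process_sigma X A -> process_sigma Df B ->
  process_sigma Y C -> measurable A -> measurable B -> measurable C ->
  P (A `&` B `&` C) = (P A * P B * P C)%E.
Proof.
move=> sA sB sC mA mB mC.
have := @ind (finset.setTfor 'I_3) (fun i : 'I_3 => nth set0 [:: A; B; C] i).
rewrite (_ : \bigcap_(i in _) _ = A `&` B `&` C); last first.
  apply/seteqP; split=> w.
    move=> h; split; first split.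
    - by have := h (inord 0); rewrite /= inordK//; apply; rewrite /= finset.in_setT.
    - by have := h (inord 1); rewrite /= inordK//; apply; rewrite /= finset.in_setT.
    - by have := h (inord 2); rewrite /= inordK//; apply; rewrite /= finset.in_setT.
  by move=> [[wA wB] wC] [[|[|[|]]]]//.
rewrite big_mkcond/= !big_ord_recr big_ord0/= !finset.in_setT mul1r => h.
have {}h : fine (P (A `&` B `&` C)) = fine (P A) * fine (P B) * fine (P C).
  by apply: h => -[[|[|[|]]]].
rewrite -[LHS]fineK ?fin_num_measure//; last by apply: measurableI => //; exact: measurableI.
by rewrite h !EFinM !fineK// fin_num_measure.
Qed.

Local Notation q n := (count_prob lambda n).

Lemma prob_state n t : 0 <= t -> P [set w | M t w = n] = (q n t)%:E.
Proof. by move=> t0; case: cM => _ ->. Qed.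

Lemma measurable_state n t : 0 <= t -> measurable [set w | M t w = n].
Proof.
move=> t0; rewrite state_preimage -[X in measurable X]setTI; apply: mX => //.
Qed.

Lemma count_prob01 n x : 0 <= x -> 0 <= q n x <= 1.
Proof.
by move=> x0; rewrite -!lee_fin -prob_state// measure_ge0 probability_le1//; exact: measurable_state.
Qed.

Lemma cvg_count_prob n (x : nat -> R) l : x m @[m --> \oo] --> l ->
  q n (x m) @[m --> \oo] --> q n l.
Proof.
move=> xl; apply: cvg_big => [|z _]; first exact: add_continuous.
apply: cvgM; last first.
  by apply: continuous_cvg; [exact: continuous_expR|apply: cvgN; exact: cvgMr].
apply: cvg_big => [|j _]; first exact: mul_continuous.
apply: cvgMl; apply: (continuous_cvg _ (@exprn_continuous R (z j) _)).
exact: cvgMr.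
Qed.

Local Notation sigma m x := (@grid_point R m (grid_index m x)).

Lemma measurable_index_fun (V : T -> R) m i : measurable_fun setT V ->
  measurable [set w | grid_index m (V w) = i].
Proof.
by move=> mV; have := mV measurableT _ (measurable_grid_index m i); rewrite setTI.
Qed.

Let measurable_sigma (V : T -> R) m : measurable_fun setT V ->
  measurable_fun setT (fun w => sigma m (V w)).
Proof.
move=> mV; apply: (@measurable_index_comp _ _ _ _ (fun w => grid_index m (V w)) (grid_point m)).
by move=> i; exact: measurable_index_fun.
Qed.

Let mDf y : 0 <= y -> measurable_fun setT (Df y).
Proof. exact: (measurable_subordinator subf). Qed.

Lemma unit_bounded_subordinated n y m : 0 <= y ->
  unit_bounded (fun w => q n (sigma m (Df y w))).
Proof.
move=> y0; split; last by move=> w; apply: count_prob01; exact: grid_point_ge0.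
apply: (@measurable_index_comp _ _ _ _ (fun w => grid_index m (Df y w)) (fun i => q n (grid_point m i))).
by move=> i; apply: measurable_index_fun; exact: mDf.
Qed.

Lemma prob_state_subordinated m n y : 0 <= y ->
  P [set w | M (sigma m (Df y w)) w = n] = (\int[P]_w q n (sigma m (Df y w)))%:E.
Proof.
move=> y0; pose U w := grid_index m (Df y w).
have mU i : measurable [set w | U w = i] by apply: measurable_index_fun; exact: mDf.
have mB i : measurable [set w | M (grid_point m i) w = n].
  by apply: measurable_state; exact: grid_point_ge0.
rewrite (@prob_freeze _ _ _ P U (fun i => [set w | M (grid_point m i) w = n]))//.
  rewrite -unit_bounded_integral; last exact: unit_bounded_subordinated.
  by apply: eq_integral => w _; rewrite prob_state//; exact: grid_point_ge0.
move=> i; have sM : process_sigma X [set w | M (grid_point m i) w = n].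
  by rewrite state_preimage; apply: process_sigma_preimage => //; exact: grid_point_ge0.
have sD : process_sigma Df [set w | U w = i].
  exact: process_sigma_index.
have := independent3E sM sD (@process_sigmaT Y) (mB i) (mU i) measurableT.
by rewrite setIT probability_setT mule1 setIC muleC.
Qed.

(** Conditioning on the cell of [Y t]. That the event selected by the cell is
independent of it is checked by splitting this event along the cells of the
subordinator, where the independence of the three processes applies. *)
Lemma prob_state_discretized m n t : 0 <= t ->
  P [set w | M (sigma m (Df (sigma m (Y t w)) w)) w = n] =
  (\int[P]_w \int[P]_v q n (sigma m (Df (sigma m (Y t w)) v)))%:E.
Proof.
move=> t0; pose U w := grid_index m (Y t w).
have mU i : measurable [set w | U w = i] by exact: measurable_index_fun.
pose U' i w := grid_index m (Df (grid_point m i) w).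
have mU' i j : measurable [set w | U' i w = j].
  by apply: measurable_index_fun; apply: mDf; exact: grid_point_ge0.
pose B' j := [set w | M (grid_point m j) w = n].
have mB' j : measurable (B' j) by apply: measurable_state; exact: grid_point_ge0.
pose B i := [set w | M (sigma m (Df (grid_point m i) w)) w = n].
have mB i : measurable (B i).
  rewrite /B state_preimage -[X in measurable X]setTI.
  apply: (measurable_process_comp mX cX) => //; last by move=> w; exact: grid_point_ge0.
  by apply: measurable_sigma; apply: mDf; exact: grid_point_ge0.
rewrite (@prob_freeze _ _ _ P U B)//.
  rewrite -unit_bounded_integral.
    apply: eq_integral => w _; rewrite /B prob_state_subordinated//; exact: grid_point_ge0.
  split; last first.
    by move=> w; apply: unit_bounded_mean; apply: unit_bounded_subordinated; exact: grid_point_ge0.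
  exact: (@measurable_index_comp _ _ _ _ U (fun i => \int[P]_v q n (sigma m (Df (grid_point m i) v)))).
move=> i; pose E := [set w | U w = i].
rewrite (_ : _ `&` _ = [set w | (E `&` B' (U' i w)) w])//.
rewrite (@prob_bigcup_level _ _ _ P (U' i) (fun j => E `&` B' j))//; last first.
  by move=> j; apply: measurableI; [exact: mU|exact: mB'].
rewrite (_ : B i = [set w | B' (U' i w) w])// (@prob_bigcup_level _ _ _ P (U' i) B')//.
have PE : P [set w | U w = i] = (fine (P [set w | U w = i]))%:E by rewrite fineK// fin_num_measure.
rewrite PE -nneseriesZl//; apply: eq_eseriesr => j _; rewrite -PE.
have sM : process_sigma X (B' j).
  by rewrite /B' state_preimage; apply: process_sigma_preimage => //; exact: grid_point_ge0.
have sD : process_sigma Df [set w | U' i w = j].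
  by apply: process_sigma_index; exact: grid_point_ge0.
have sY : process_sigma Y E.
  exact: process_sigma_index.
have := independent3E sM sD (@process_sigmaT Y) (mB' j) (mU' i j) measurableT.
rewrite setIT probability_setT mule1 setIC => ->.
have := independent3E sM sD sY (mB' j) (mU' i j) (mU i).
rewrite (_ : B' j `&` _ `&` E = [set w | U' i w = j] `&` (E `&` B' j)).
  by move=> ->; rewrite muleC.
by rewrite [B' j `&` _]setIC -setIA [B' j `&` _]setIC.
Qed.

(** A continuous function that agrees with the indicator of [n] on the integers, so
that convergence of the states passes to the probabilities. *)
Let hat n (x : R) : R := Num.max 0 (1 - `|x - n%:R|).

Let hatE n j : hat n j%:R = (j == n)%:R.
Proof.
rewrite /hat; case: eqVneq => [->|jn]; first by rewrite subrr normr0 subr0 max_r.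
apply: max_l; rewrite subr_le0.
wlog ij : j n jn / (j < n)%N.
  move=> H; have [jln|nlj|/eqP] := ltngtP j n; last by rewrite (negbTE jn).
    exact: H.
  by rewrite distrC; apply: H; rewrite // eq_sym.
by rewrite distrC ger0_norm ?subr_ge0 ?ler_nat 1?ltnW// lerBrDl natr1 ler_nat.
Qed.

Let prob_hat n (Z : T -> R) : measurable_fun setT Z -> (forall w, 0 <= Z w) ->
  unit_bounded (fun w => hat n (X (Z w) w)) /\
  \int[P]_w hat n (X (Z w) w) = fine (P [set w | M (Z w) w = n]).
Proof.
move=> mZ Z0; pose A := [set w | M (Z w) w = n].
have mA : measurable A.
  rewrite /A state_preimage -[X in measurable X]setTI.
  exact: (measurable_process_comp mX cX).
have hA : (fun w => hat n (X (Z w) w)) = \1_A.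
  apply/funext => w; rewrite hatE indicE; congr (_%:R); congr nat_of_bool.
  by apply/idP/idP; rewrite inE => /eqP.
rewrite hA; split; first split => //.
  by move=> w; rewrite indicE; case: (_ \in _) => /=; rewrite ?lexx ?ler01.
by rewrite /Rintegral integral_indic// setIT.
Qed.

Let cvg_hat n (x : nat -> R) l : x m @[m --> \oo] --> l ->
  hat n (x m) @[m --> \oo] --> hat n l.
Proof.
apply: continuous_cvg; apply: (@continuous_max _ _ (cst 0) (fun y : R => 1 - `|y - n%:R|)).
  exact: cvg_cst.
apply: cvgB; first exact: cvg_cst.
by apply: cvg_norm; apply: cvgB; [exact: cvg_id|exact: cvg_cst].
Qed.

Let sigma_ge m x : x <= sigma m x.
Proof. exact/ltW/grid_point_gt. Qed.

Let cvg_subordinator y w : 0 <= y -> Df (sigma m y) w @[m --> \oo] --> Df y w.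
Proof.
move=> y0; apply: (right_continuous_approx (cD w) y0 (fun=> lexx y)); exact: cvg_cst.
Qed.

Let subordinator_sigma m y w : 0 <= y -> Df y w <= Df (sigma m y) w.
Proof. by move=> y0; apply: (subordinator_homo subf) => //; exact: sigma_ge. Qed.

(** Both sides of [prob_state_discretized] converge as the mesh tends to [0]: the
grid points lie to the right of the times, so right-continuity gives the
convergence of the states, and all the integrands lie in [[0, 1]]. *)
Lemma random_time_law n t : 0 <= t ->
  fine (P [set w | M (Df (Y t w) w) w = n]) =
  \int[P]_w \int[P]_v q n (Df (Y t w) v).
Proof.
move=> t0.
have mDY : measurable_fun setT (fun w => Df (Y t w) w).
  by apply: (measurable_process_comp _ cD) => //; exact: mDf.
have DY0 w : 0 <= Df (Y t w) w by exact: (subordinator_ge0 subf).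
pose Z m w := sigma m (Df (sigma m (Y t w)) w).
have mZ m : measurable_fun setT (Z m).
  apply: measurable_sigma; apply: (measurable_process_comp _ cD) => //.
  - exact: measurable_sigma.
  - by move=> w; exact: grid_point_ge0.
have Z0 m w : 0 <= Z m w by exact: grid_point_ge0.
have cA : \int[P]_w hat n (X (Z m w) w) @[m --> \oo] -->
    \int[P]_w hat n (X (Df (Y t w) w) w).
  apply: (unit_bounded_cvg (g_ := fun m w => hat n (X (Z m w) w))).
    by move=> m; case: (prob_hat n (mZ m) (Z0 m)).
  move=> w; apply: cvg_hat.
  apply: (right_continuous_approx (cX w) (DY0 w) (y := fun m => Df (sigma m (Y t w)) w)).
    by move=> m; exact: subordinator_sigma.
  exact: cvg_subordinator.
have cB : (\int[P]_w \int[P]_v q n (sigma m (Df (sigma m (Y t w)) v))) @[m --> \oo] -->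
    \int[P]_w \int[P]_v q n (Df (Y t w) v).
  apply: (unit_bounded_cvg (g_ := fun m w => \int[P]_v q n (sigma m (Df (sigma m (Y t w)) v)))).
    move=> m; split; last first.
      by move=> w; apply: unit_bounded_mean; apply: unit_bounded_subordinated; exact: grid_point_ge0.
    apply: (@measurable_index_comp _ _ _ _ (fun w => grid_index m (Y t w))
      (fun i => \int[P]_v q n (sigma m (Df (grid_point m i) v)))).
    by move=> i; exact: measurable_index_fun.
  move=> w.
  apply: (unit_bounded_cvg (g_ := fun m v => q n (sigma m (Df (sigma m (Y t w)) v)))).
    by move=> m; apply: unit_bounded_subordinated; exact: grid_point_ge0.
  move=> v; apply: cvg_count_prob.
  apply: (grid_point_cvg (x := Df (Y t w) v)).
  - exact: (subordinator_ge0 subf).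
  - by move=> m; exact: subordinator_sigma.
  - exact: cvg_subordinator.
rewrite -(prob_hat n mDY DY0).2 -(cvg_lim _ cA)// -(cvg_lim _ cB)//.
congr (limn _); apply/funext => m.
by rewrite (prob_hat n (mZ m) (Z0 m)).2 prob_state_discretized.
Qed.

End conditioning.

(** * Linearity of Mittag-Leffler series and conclusion *)
Section mittag_leffler_algebra.
Context {R : realType}.
Implicit Types (alpha t : R) (b : nat -> R).

Lemma mittag_leffler_cvg alpha b t : 0 < alpha -> geom_bounded b -> 0 <= t ->
  series (fun j => ml_coef alpha b j * (t `^ alpha) ^+ j) @ \oo --> mittag_leffler alpha b t.
Proof.
move=> a0 gb t0.
have : cvg (pseries (ml_coef alpha b) (t `^ alpha) @ \oo).
  exact: (entire_cvg (entire_ml_coef a0 gb)).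
by [].
Qed.

Lemma mittag_leffler0 alpha b : 0 < alpha -> geom_bounded b -> mittag_leffler alpha b 0 = b 0%N.
Proof.
move=> a0 gb; rewrite /mittag_leffler powR0 ?gt_eqF//; apply/cvg_lim => //.
apply: (@cvg_near_cst _ _ (b 0%N)).
exists 1%N => // n /=; case: n => // n _; apply/eqP.
rewrite /pseries /series/= big_nat_recl// big1_seq ?addr0.
  by rewrite /ml_coef expr0 mulr1 mulr0 add0r (@Gamma_nat R 0%N : Gamma (1 : R) = 1) divr1.
by move=> i _; rewrite exprS mul0r mulr0.
Qed.

Lemma mittag_leffler_sum alpha t (I : Type) (s : seq I) (c : I -> R) (b : I -> nat -> R) :
  0 < alpha -> 0 <= t -> (forall i, geom_bounded (b i)) ->
  mittag_leffler alpha (fun j => \sum_(i <- s) c i * b i j) t =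
  \sum_(i <- s) c i * mittag_leffler alpha (b i) t.
Proof.
move=> a0 t0 gb; rewrite /mittag_leffler; apply/cvg_lim => //.
have cs : (fun J => \sum_(i <- s) c i * series (fun j => ml_coef alpha (b i) j * (t `^ alpha) ^+ j) J)
    @ \oo --> \sum_(i <- s) c i * mittag_leffler alpha (b i) t.
  apply: cvg_big => [|i _]; first exact: add_continuous.
  by apply: cvgMr; exact: mittag_leffler_cvg.
apply: cvg_trans cs; apply: near_eq_cvg; apply: nearW => J.
rewrite /pseries /series/=; under eq_bigr do rewrite big_distrr/=.
rewrite exchange_big/=; apply: eq_bigr => j _.
rewrite /ml_coef big_distrl big_distrl/=; apply: eq_bigr => i _.
by rewrite !mulrA.
Qed.

End mittag_leffler_algebra.

Unset Implicit Arguments.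

Theorem mainTheorem18 (d : measure_display) (T : measurableType d)
    (R : realType) (P : probability T R)
    (k : nat) (lambda : 'I_k -> R) (f : R -> R) (alpha : R)
    (M : R -> T -> nat) (Df Dalpha : R -> T -> R) :
  (0 < k)%N ->
  (forall j, 0 < lambda j) ->
  bernstein f ->
  0 < alpha -> alpha < 1 ->
  counting_process P lambda M ->
  subordinator P f Df ->
  subordinator P (fun s => s `^ alpha) Dalpha ->
  let Y := inverse_process Dalpha in
  independent3 P (fun t w => (M t w)%:R) Df Y ->
  let p := state_probability P (fun t w => M (Df (Y t w) w) w) in
  let Lambda := total_rate lambda in
  (forall (n : nat) (t : R), 0 < t ->
     caputo_defined alpha (p n) t /\
     caputo alpha (p n) t =
       - f Lambda * p n t
       - \sum_(1 <= m < n.+1) \sum_(x in Omega k m)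
           derive1n (\sum_(j < k) x j)%N f Lambda
           * (\prod_(j < k) ((- lambda j) ^+ x j / (x j)`!%:R))
           * p (n - m)%N t)
  /\ p 0%N 0 = 1
  /\ (forall n : nat, (1 <= n)%N -> p n 0 = 0).
Proof.
move=> k0 lambda0 _ alpha0 alpha1 cM subf subD Y ind p Lambda.
have Lambda0 : 0 < total_rate lambda.
  by rewrite /total_rate (bigD1 (Ordinal k0))//= ltr_pwDl// sumr_ge0// => j _; rewrite ltW.
have gb N m : geom_bounded (state_coef lambda f N m) by exact: geom_bounded_exp.
have pE N m t : (m < N)%N -> 0 <= t -> p m t = mittag_leffler alpha (state_coef lambda f N m) t.
  move=> mN t0; rewrite /p /state_probability (random_time_law cM subf _ _ ind)//.
  - pose q y := \int[P]_v count_prob lambda m (Df y v).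
    apply: (@expectation_inverse_process _ _ _ P _ _ alpha0 subD _ q) => // y y0.
    exact: (state_series subf).
  - by move=> s; exact: (measurable_inverse_process subD).
  - by move=> s w; exact: inverse_process_ge0.
have p0 n : p n 0 = (n == 0%N)%:R.
  by rewrite (pE n.+1)// mittag_leffler0// state_coef0.
split; last by split=> [|n n0]; rewrite p0// gtn_eqF.
move=> n t t0; have [def ->] := caputo_mittag_leffler alpha0 alpha1 (gb n.+1 n) t0
  (fun s => pE n.+1 n s (ltnSn n)).
split => //.
pose c (i : 'I_n.+1) := - (rate_poly lambda f n.+1)`_i.
transitivity (mittag_leffler alpha (fun j => \sum_(i < n.+1) c i * state_coef lambda f n.+1 (n - i) j) t).
  congr mittag_leffler; apply/funext => j; rewrite state_coefS -sumrN.
  by apply: eq_bigr => i _; rewrite mulNr.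
rewrite mittag_leffler_sum ?(ltW t0)//.
rewrite big_ord_recl/= subn0 /c rate_poly0// -(pE n.+1 n) ?(ltW t0)//; congr (_ + _).
rewrite big_add1/= big_mkord -sumrN; apply: eq_bigr => i _.
rewrite mulNr rate_polyE; last by rewrite ltnS.
rewrite -(pE n.+1 (n - bump 0 i)%N) ?ltnS ?leq_subr ?(ltW t0)//.
by rewrite big_distrl.
Qed.
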